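(* Let $n\ge3$ and let $CL_n$ be the circular ladder graph. The total cut complex $\Delta_{n-1}^t(CL_n)$ (which is $n$-dimensional) is homotopy equivalent to a wedge of $n-1$ copies of $\mathbb{S}^2$ if $n$ is odd, and to a wedge of $(n-1)^2$ copies of $\mathbb{S}^2$ if $n$ is even.
   Context: The circular ladder graph $CL_n$ has $2n$ vertices $\{i^+,i^-:1\le i\le n\}$ and edges $i^+(i+1)^+$, $i^-(i+1)^-$ and $i^+i^-$ for $1\le i\le n$, indices modulo $n$. For a graph $G=(V,E)$, the total cut complex $\Delta_k^t(G)$ is the simplicial complex whose facets are the sets $V\setminus S$ for $S$ an independent set of size $k$ in $G$. *)

(* Defs.v *)
From HB Require Import structures.
From mathcomp Require Import all_boot all_order all_algebra.
From mathcomp Require Import all_classical all_reals all_analysis.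
From mathcomp Require Import homotopy.

Set Implicit Arguments.
Unset Strict Implicit.
Unset Printing Implicit Defensive.

Import Order.TTheory GRing.Theory Num.Theory.
Import numFieldNormedType.Exports.

Local Open Scope classical_set_scope.
Local Open Scope ring_scope.

(* The vertices i^+ and i^- are (i, true) and (i, false); [ordS] is the
   successor modulo n. For n >= 3 this relation is a simple graph. *)
Definition circular_ladder (n : nat) : rel ('I_n * bool) :=
  fun u v =>
    (u.2 == v.2) && ((v.1 == ordS u.1) || (u.1 == ordS v.1)) ||
    (u.1 == v.1) && (u.2 != v.2).

Definition independent (V : finType) (e : rel V) (S : {set V}) : bool :=
  [forall u in S, forall v in S, ~~ e u v].

(* An abstract simplicial complex on V is given by the set of its faces,
   the empty face included. *)
Definition complex_of_facets (V : finType) (F : {set {set V}}) : {set {set V}} :=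
  [set s : {set V} | [exists t in F, s \subset t]].

Definition total_cut_complex (V : finType) (e : rel V) (k : nat) :
    {set {set V}} :=
  complex_of_facets
    [set ~: S | S in [set S : {set V} | independent e S && (#|S| == k)]%SET].

(* Only meaningful for a complex with a nonempty face. *)
Definition complex_dim (V : finType) (K : {set {set V}}) : nat :=
  (\max_(s in K) #|s|).-1.

(* The points of |K| are given by their barycentric coordinates. As V is finite,
   the topology of |K| is the one induced by the product topology on R^V. *)
Definition realization_set (R : realType) (V : finType) (K : {set {set V}}) :
    set (prod_topology (fun _ : V => R : topologicalType)) :=
  [set x | [/\ forall v, 0 <= x v, \sum_v x v = 1
             & [set v | x v != 0]%SET \in K]].

Definition realization (R : realType) (V : finType) (K : {set {set V}}) :
    topologicalType :=
  set_type (@realization_set R V K).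

Definition sphere (R : realType) (d : nat) : set 'rV[R]_d.+1 :=
  [set x | \sum_i x ord0 i ^+ 2 = 1].

Lemma sphere_delta (R : realType) (d : nat) :
  sphere (delta_mx ord0 ord0 : 'rV[R]_d.+1).
Proof.
rewrite /sphere /= big_ord_recl big1 => [|i _]; rewrite !mxE ?eqxx /=.
  by rewrite expr1n addr0.
by rewrite expr0n.
Qed.

Definition sphere_point (R : realType) (d : nat) : set_type (@sphere R d) :=
  SigSub (mem_set (sphere_delta R d)).

(* With the library's [wedge] this is the empty space, not a point, if m = 0. *)
Definition wedge_of_spheres (R : realType) (d m : nat) : topologicalType :=
  wedge (fun _ : 'I_m => sphere_point R d).

Definition homotopic (R : realType) (X Y : topologicalType) (f g : X -> Y) :
    Prop :=
  exists H : X * R -> Y,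
    [/\ {within [set: X] `*` `[0, 1], continuous H},
        forall x, H (x, 0) = f x
      & forall x, H (x, 1) = g x].

Definition homotopy_equivalent (R : realType) (X Y : topologicalType) : Prop :=
  exists (f : X -> Y) (g : Y -> X),
    [/\ continuous f, continuous g,
        homotopic R (g \o f) id & homotopic R (f \o g) id].

(* Main.v *)
Require Import Defs.
From HB Require Import structures.
From mathcomp Require Import all_boot all_order all_algebra.
From mathcomp Require Import all_classical all_reals all_analysis.
From mathcomp Require Import homotopy.
From mathcomp Require Import ring lra.

(** Both complexes are homotopy equivalent to a join of three finite discrete
    sets. Relabel the vertices so that the sides of the ladder become the two
    alternating sequences of vertices. For even n, the faces are the vertex sets
    having at most one vertex on one of the sides, and the complex is
    equivalent to D_n * D_n * D_2; for odd n, they are the sets all of whose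
    vertices on one side lie weakly above those on the other side, and the
    complex is equivalent to D_2 * D_n * D_2. All the homotopies are straight
    lines between maps given by explicit formulas in barycentric coordinates.

    In a join of three pointed discrete sets, the triangles without base vertex
    are the complement of a contractible subcomplex. A contraction of that
    subcomplex is extended to the whole join, damped by the distance to the
    subcomplex, so the join is equivalent to its quotient by the subcomplex; this
    is a wedge of 2-spheres, one for each of these triangles, by stereographic
    projection. *)

Set Implicit Arguments.
Unset Strict Implicit.
Unset Printing Implicit Defensive.
Import Order.TTheory GRing.Theory Num.Theory.
Import numFieldNormedType.Exports.
Local Open Scope classical_set_scope.
Local Open Scope ring_scope.

(** * Homotopies and compact quotients *)

(** An independent set of size [n - 1] has one vertex on every rung but one and alternates along the
    remaining path. After the relabelling it keeps to one side, except that the passage from the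
    last rung to the first changes side exactly when n is odd. In both cases the complex is a union
    of two contractible subcomplexes, and the last factor D_2 is the resulting suspension. For even
    n each piece joins a discrete D_n on one side with the full simplex on the other, and the pieces
    meet in D_n * D_n. For odd n the pieces are cones, meeting in the two full sides together with
    the rungs, which is D_2 * D_n up to homotopy. The triangles without base vertex number
    (n-1)(n-1)(2-1) and (2-1)(n-1)(2-1). A straight line between two maps exists as soon as their
    supports span a common face, so homotopies reduce to the combinatorics of supports and maps can
    be given by unnormalized weights. The price is that weights must be switched on and off so that
    incompatible vertices never meet; the thresholds and the intermediate maps serve this
    purpose. *)

Lemma cont_comp {X Y Z : topologicalType} (f : X -> Y) (g : Y -> Z) :
  continuous g -> continuous f -> continuous (fun x => g (f x)).
Proof. by move=> cg cf x; apply: continuous_comp; [exact: cf|exact: cg]. Qed.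

Section RealContinuity.
Context {R : realType} {X : topologicalType}.
Implicit Types f g : X -> R.

Lemma contD f g : continuous f -> continuous g -> continuous (fun x => f x + g x).
Proof. by move=> cf cg x; apply: continuousD; [exact: cf|exact: cg]. Qed.

Lemma contN f : continuous f -> continuous (fun x => - f x).
Proof. by move=> cf x; apply: continuousN; exact: cf. Qed.

Lemma contM f g : continuous f -> continuous g -> continuous (fun x => f x * g x).
Proof. by move=> cf cg x; apply: continuousM; [exact: cf|exact: cg]. Qed.

Lemma contV f : (forall x, f x != 0) -> continuous f -> continuous (fun x => (f x)^-1).
Proof. by move=> f0 cf x; apply: continuousV => //; exact: cf. Qed.

Lemma cont_min f g : continuous f -> continuous g ->
  continuous (fun x => Num.min (f x) (g x)).
Proof. by move=> cf cg x; apply: continuous_min; [exact: cf|exact: cg]. Qed.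

Lemma cont_max f g : continuous f -> continuous g ->
  continuous (fun x => Num.max (f x) (g x)).
Proof. by move=> cf cg x; apply: continuous_max; [exact: cf|exact: cg]. Qed.

Lemma cont_cst (a : R) : continuous (fun _ : X => a).
Proof. by move=> x; exact: cst_continuous. Qed.

Lemma cont_sum (I : finType) (P : pred I) (f : I -> X -> R) :
  (forall i, P i -> continuous (f i)) -> continuous (fun x => \sum_(i | P i) f i x).
Proof.
move=> cf; have -> : (fun x => \sum_(i | P i) f i x) = \sum_(i | P i) f i.
  by apply/funext => x; rewrite fct_sumE.
elim/big_ind : _ => [|u v cu cv|//]; [exact: cont_cst|exact: contD].
Qed.

Lemma cont_prod (I : finType) (P : pred I) (f : I -> X -> R) :
  (forall i, P i -> continuous (f i)) -> continuous (fun x => \prod_(i | P i) f i x).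
Proof.
move=> cf; have -> : (fun x => \prod_(i | P i) f i x) = \prod_(i | P i) f i.
  by apply/funext => x; rewrite fct_prodE.
elim/big_ind : _ => [|u v cu cv|//]; [exact: cont_cst|exact: contM].
Qed.

End RealContinuity.

Definition clamp01 (R : realType) (t : R) : R := Num.max 0 (Num.min 1 t).

Section Clamp.
Context {R : realType}.
Implicit Types t : R.

Lemma clamp01_ge0 t : 0 <= clamp01 t.
Proof. by rewrite /clamp01 le_max lexx. Qed.

Lemma clamp01_le1 t : clamp01 t <= 1.
Proof. by rewrite /clamp01 ge_max ler01 ge_min lexx. Qed.

Lemma clamp01_itv t : clamp01 t \in `[0, 1].
Proof. by rewrite in_itv /= clamp01_ge0 clamp01_le1. Qed.

Lemma clamp01_0 t : t <= 0 -> clamp01 t = 0.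
Proof. by move=> t0; rewrite /clamp01 min_r ?max_l// (le_trans t0). Qed.

Lemma clamp01_1 t : 1 <= t -> clamp01 t = 1.
Proof. by move=> t1; rewrite /clamp01 min_l// max_r. Qed.

Lemma clamp01_gt0 t : 0 < clamp01 t -> 0 < t.
Proof. by rewrite /clamp01 lt_max ltxx /= lt_min => /andP[]. Qed.

Lemma cont_clamp01 {X : topologicalType} (f : X -> R) :
  continuous f -> continuous (fun x => clamp01 (f x)).
Proof.
move=> cf; apply: cont_max; first exact: cont_cst.
by apply: cont_min => //; exact: cont_cst.
Qed.
End Clamp.

(* The homotopy is globally continuous in time (it may be taken constant
   outside [0, 1]) and satisfies [Phi x] along the path of [x]. *)
Definition homotopic_in (R : realType) (X Y : topologicalType)
    (Phi : X -> Y -> Prop) (f g : X -> Y) : Prop :=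
  exists H : X * R -> Y,
    [/\ continuous H, forall x, H (x, 0) = f x, forall x, H (x, 1) = g x
      & forall x t, Phi x (H (x, t))].


Section Homotopy.
Context {R : realType}.

Lemma homotopic_in_homotopic (X Y : topologicalType) Phi (f g : X -> Y) :
  homotopic_in R Phi f g -> homotopic R f g.
Proof.
by move=> [H [cH H0 H1 _]]; exists H; split => //; exact: continuous_subspaceT.
Qed.

Lemma homotopic_in_sub (X Y : topologicalType) (Phi Psi : X -> Y -> Prop)
    (f g : X -> Y) : (forall x y, Phi x y -> Psi x y) ->
  homotopic_in R Phi f g -> homotopic_in R Psi f g.
Proof. by move=> sub [H [cH H0 H1 PH]]; exists H; split => // x t; exact/sub. Qed.

Lemma homotopic_in_top (X Y : topologicalType) (Phi : X -> Y -> Prop)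
    (f g : X -> Y) :
  homotopic_in R Phi f g -> homotopic_in R (fun _ _ => True) f g.
Proof. exact: homotopic_in_sub. Qed.

Lemma homotopic_in_refl (X Y : topologicalType) (Phi : X -> Y -> Prop)
    (f : X -> Y) : continuous f -> (forall x, Phi x (f x)) ->
  homotopic_in R Phi f f.
Proof.
move=> cf Pf; exists (f \o fst); split => // z.
by apply: continuous_comp; [exact: cvg_fst|exact: cf].
Qed.

Lemma closed_pasting (X Y : topologicalType) (I : finType) (C : I -> set X)
    (F : I -> X -> Y) (f : X -> Y) :
  (forall i, closed (C i)) -> (forall i, continuous (F i)) ->
  (forall x, exists i, C i x) -> (forall i x, C i x -> f x = F i x) ->
  continuous f.
Proof.
move=> cC cF cover fF; apply/continuous_closedP => D cD.
rewrite (_ : f @^-1` D = \bigcup_(i in [set: I]) (C i `&` F i @^-1` D)).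
  apply: closed_bigcup => [|i _]; first exact: finite_finset.
  by apply: closedI => //; move/continuous_closedP: (cF i); exact.
apply/seteqP; split => x /= => [Dx|[i _ [Cx]]]; last by rewrite (fF i).
by have [i Cx] := cover x; exists i => //; split => //=; rewrite -(fF i).
Qed.

Lemma continuous_pair (X Y Z : topologicalType) (f : X -> Y) (g : X -> Z) :
  continuous f -> continuous g -> continuous (fun x => (f x, g x)).
Proof. by move=> cf cg x; apply: cvg_pair; [exact: cf|exact: cg]. Qed.

Lemma homotopic_in_trans (X Y : topologicalType) (Phi : X -> Y -> Prop)
    (f g h : X -> Y) :
  homotopic_in R Phi f g -> homotopic_in R Phi g h -> homotopic_in R Phi f h.
Proof.
move=> [H [cH H0 H1 PH]] [G [cG G0 G1 PG]].
pose F (b : bool) (z : X * R) := if b then H (z.1, clamp01 (2 * z.2))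
  else G (z.1, clamp01 (2 * z.2 - 1)).
pose C (b : bool) : set (X * R) :=
  if b then [set z | z.2 <= 2^-1] else [set z | 2^-1 <= z.2].
pose E (z : X * R) := F (z.2 <= 2^-1) z.
have cfst : continuous (@fst X R) by move=> z; exact: cvg_fst.
have csnd : continuous (@snd X R) by move=> z; exact: cvg_snd.
exists E; split.
- apply: (@closed_pasting _ _ _ C F).
  + have cl (A : set R) : closed A -> closed (snd @^-1` A : set (X * R)).
      by move: csnd => /continuous_closedP; exact.
    case; first exact: (cl [set t | t <= 2^-1] (@closed_le _ _)).
    exact: (cl [set t | 2^-1 <= t] (@closed_ge _ _)).
  + have aux (K : X * R -> Y) (u : X * R -> R) : continuous K -> continuous u ->
        continuous (fun z => K (z.1, clamp01 (u z))).
      move=> cK cu; apply: (@cont_comp _ _ _ (fun z => (z.1, clamp01 (u z))) _ cK).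
      by apply: continuous_pair => //; exact: cont_clamp01.
    case; apply: aux => //.
      by apply: contM => //; exact: cont_cst.
    apply: contD; last exact: cont_cst.
    by apply: contM => //; exact: cont_cst.
  + by move=> z; case: (leP z.2 2^-1) => zt; [exists true|exists false => /=; exact: ltW].
  + case=> z /=; rewrite /E; first by move=> ->.
    have [z1 z2|//] := boolP (z.2 <= 2^-1).
    have -> : z = (z.1, 2^-1).
      by rewrite [LHS]surjective_pairing; congr pair; apply/le_anti; rewrite z1 z2.
    rewrite /F /= mulfV ?pnatr_eq0// subrr clamp01_1// clamp01_0//.
    by rewrite G0 H1.
- by move=> x; rewrite /E /F /= invr_ge0 ler0n mulr0 clamp01_0// H0.
- move=> x; rewrite /E /F /= ifF; last by apply/negbTE; rewrite -ltNge; lra.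
  by rewrite clamp01_1 ?G1//; lra.
- by move=> x t; rewrite /E /F; case: ifP.
Qed.

Lemma homotopic_in_comp (X Y Z W : topologicalType) (f g : Y -> Z)
    (u : X -> Y) (v : Z -> W) : continuous u -> continuous v ->
  homotopic_in R (fun _ _ => True) f g ->
  homotopic_in R (fun _ _ => True) (v \o f \o u) (v \o g \o u).
Proof.
move=> cu cv [H [cH H0 H1 _]]; exists (fun z => v (H (u z.1, z.2))).
split => // [|x|x] /=; rewrite ?H0 ?H1//.
apply: (@cont_comp _ _ _ (fun z => H (u z.1, z.2)) _ cv).
apply: (@cont_comp _ _ _ (fun z => (u z.1, z.2)) _ cH).
apply: continuous_pair => /= {}z; last exact: cvg_snd.
by apply: continuous_comp; [exact: cvg_fst|exact: cu].
Qed.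

Definition hequiv (X Y : topologicalType) : Prop :=
  exists (f : X -> Y) (g : Y -> X),
    [/\ continuous f, continuous g,
        homotopic_in R (fun _ _ => True) (g \o f) id
      & homotopic_in R (fun _ _ => True) (f \o g) id].

Lemma hequiv_homotopy_equivalent (X Y : topologicalType) :
  hequiv X Y -> homotopy_equivalent R X Y.
Proof.
move=> [f [g [cf cg gf fg]]]; exists f, g.
by split => //; [exact: homotopic_in_homotopic gf|exact: homotopic_in_homotopic fg].
Qed.

Lemma hequiv_trans (X Y Z : topologicalType) :
  hequiv X Y -> hequiv Y Z -> hequiv X Z.
Proof.
move=> [f [g [cf cg gf fg]]] [f' [g' [cf' cg' gf' fg']]].
exists (f' \o f), (g \o g'); split.
- by move=> x; apply: continuous_comp; [exact: cf|exact: cf'].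
- by move=> x; apply: continuous_comp; [exact: cg'|exact: cg].
- by apply: homotopic_in_trans gf; exact: (homotopic_in_comp cf cg gf').
- by apply: homotopic_in_trans fg'; exact: (homotopic_in_comp cg' cf' fg).
Qed.

End Homotopy.

(** * Collapsing a subspace of a compact space *)

Section CompactQuotient.
Context {R : realType}.

Lemma hausdorff_prod (X Y : topologicalType) :
  hausdorff_space X -> hausdorff_space Y -> hausdorff_space (X * Y)%type.
Proof.
move=> hX hY [x y] [x' y'] cl; congr pair.
- apply: hX => A B nA nB.
  have [||[a b] []] := cl (A `*` setT) (B `*` setT).
  + by exists (A, setT) => //; split => //; exact: filterT.
  + by exists (B, setT) => //; split => //; exact: filterT.
  by move=> [/= Aa _] [/= Ba _]; exists a.
- apply: hY => A B nA nB.
  have [||[a b] []] := cl (setT `*` A) (setT `*` B).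
  + by exists (setT, A) => //; split => //; exact: filterT.
  + by exists (setT, B) => //; split => //; exact: filterT.
  by move=> [/= _ Aa] [/= _ Ba]; exists b.
Qed.

(** Replaces the universal property of a quotient topology: images of compact sets in a Hausdorff
    space are closed, so [F] inherits continuity from [F \o q]. It is used with S = X for the
    homotopy inverse and with S = X x [0, 1] for the homotopy. *)
Lemma closed_descend (Z Y W : topologicalType) (S : set Z) (q : Z -> Y)
    (F : Y -> W) (D : set W) : compact S -> hausdorff_space Y -> continuous q ->
  continuous (F \o q) -> closed D -> closed (q @` S `&` F @^-1` D).
Proof.
move=> cS hY cq cF cD.
rewrite (_ : _ `&` _ = q @` (S `&` (F \o q) @^-1` D)); last first.
  apply/seteqP; split => [y [[z Sz <-] Dz]|y [z [Sz Dz] <-]]; first by exists z.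
  by split => //; exists z.
apply: compact_closed => //; apply: continuous_compact.
  exact: continuous_subspaceT.
by apply: compact_closedI => //; move/continuous_closedP: cF; exact.
Qed.

(* [q] exhibits Y as the quotient X/A. The homotopy descends along [q] and its
   end map factors through [q], which gives the homotopy inverse. *)
Lemma hequiv_quotient (X Y : topologicalType) (A : set X) (q : X -> Y)
    (e : X -> X) :
  compact [set: X] -> hausdorff_space Y -> continuous q ->
  (forall y, exists x, q x = y) ->
  (forall x x', q x = q x' -> x = x' \/ A x /\ A x') ->
  (forall x x', A x -> A x' -> q x = q x') ->
  (forall x x', A x -> A x' -> e x = e x') ->
  homotopic_in R (fun x y => A x -> A y) id e -> @hequiv R X Y.
Proof.
move=> cX hY cq qsurj qinj qA eA [H [cH H0 H1 PH]].
have /choice[s qs] := qsurj.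
have ce : continuous e.
  have -> : e = fun x => H (x, 1) by apply/funext => ?; rewrite H1.
  apply: (@cont_comp _ _ _ (fun x : X => (x, 1 : R)) _ cH).
  by apply: continuous_pair => x; [exact: cvg_id|exact: cst_continuous].
(* Independence of the chosen preimage: it differs from [x] only when both lie in A, where [H] stays
   in A and [q] is constant. *)
have sq x t : q (H (s (q x), t)) = q (H (x, t)).
  have [->//|[As Ax]] := qinj _ _ (qs (q x)).
  by apply: qA; exact: PH.
have esq x : e (s (q x)) = e x.
  by have [->//|[As Ax]] := qinj _ _ (qs (q x)); exact: eA.
have cg : continuous (e \o s).
  apply/continuous_closedP => D cD.
  rewrite -[_ @^-1` _]setTI (_ : setT = q @` setT).
    apply: closed_descend => //; rewrite (_ : _ \o q = e)//.
    by apply/funext => x /=.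
  by apply/seteqP; split => // y _; exists (s y).
exists q, (e \o s); split => //.
  rewrite (_ : (e \o s) \o q = e); last by apply/funext => x /=.
  exists (fun z => H (z.1, 1 - z.2)); split => // [|x|x]; rewrite /= ?subr0 ?subrr//.
  apply: (@cont_comp _ _ _ (fun z : X * R => (z.1, 1 - z.2)) _ cH).
  apply: continuous_pair => z; first exact: cvg_fst.
  apply: contD; first exact: cont_cst.
  by apply: contN => {}z; exact: cvg_snd.
(* Time is reversed because [H] starts at the identity. Clamping it reduces continuity to Y x
   [0, 1], the image of a compact set. *)
pose G (z : Y * R) := q (H (s z.1, 1 - z.2)).
exists (fun z => G (z.1, clamp01 z.2)); split => // [|x|x]; rewrite /G /=; last 2 first.
- by rewrite clamp01_0// subr0 H1.
- by rewrite clamp01_1// subrr H0 /= qs.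
apply/continuous_closedP => D cD.
pose Q (z : X * R) := (q z.1, z.2).
pose S : set (X * R) := [set: X] `*` `[0, 1].
have cQS : closed (Q @` S `&` G @^-1` D).
  apply: closed_descend => //.
  - by apply: compact_setX => //; exact: segment_compact.
  - by apply: hausdorff_prod => //; exact: Rhausdorff.
  - apply: continuous_pair => z; last exact: cvg_snd.
    by apply: continuous_comp; [exact: cvg_fst|exact: cq].
  - rewrite (_ : G \o Q = fun z => q (H (z.1, 1 - z.2))); last first.
      by apply/funext => z /=; rewrite /G /Q /= sq.
    apply: (@cont_comp _ _ _ (fun z : X * R => H (z.1, 1 - z.2)) _ cq).
    apply: (@cont_comp _ _ _ (fun z : X * R => (z.1, 1 - z.2)) _ cH).
    apply: continuous_pair => z; first exact: cvg_fst.
    apply: contD; first exact: cont_cst.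
    by apply: contN => {}z; exact: cvg_snd.
pose c (z : Y * R) := (z.1, clamp01 z.2).
have cc : continuous c.
  apply: continuous_pair => z; first exact: cvg_fst.
  by apply: cont_clamp01 => {}z; exact: cvg_snd.
rewrite (_ : _ @^-1` D = c @^-1` (Q @` S `&` G @^-1` D)).
  by move/continuous_closedP: cc; exact.
apply/seteqP; split => z /= => [Dz|[_ Dz]//]; split => //.
exists (s z.1, clamp01 z.2); last by rewrite /Q /= qs.
by split => //=; exact: clamp01_itv.
Qed.

Lemma compact_set_type (X : topologicalType) (A : set X) :
  compact A -> compact [set: set_type A].
Proof.
move=> cA F PF _.
have PG : ProperFilter ((set_val : A -> X) @ F) by exact: fmap_proper_filter.
have GA : ((set_val : A -> X) @ F) A.
  by apply: (@filterS _ F _ setT _ _ filterT) => x _; exact: set_valP.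
have [p [Ap clp]] := cA _ PG GA.
exists (SigSub (mem_set Ap)); split => // B U FB [_ [[W oW <-] Wp WU]].
have [||y [[x Bx <-] Wx]] := clp (set_val @` B) W.
- by apply: (@filterS _ F _ B _ _ FB) => x Bx; exists x.
- exact: open_nbhs_nbhs.
by exists x; split => //; exact: WU.
Qed.

Lemma hausdorff_set_type (X : topologicalType) (A : set X) :
  hausdorff_space X -> hausdorff_space (set_type A).
Proof.
move=> hX x y cl; apply/val_inj/hX => U V nU nV.
have c := @initial_continuous _ _ (set_val : A -> X).
have [z [Uz Vz]] := cl _ _ (c x _ nU) (c y _ nV).
by exists (set_val z).
Qed.

Lemma continuous_set_type (X Y : topologicalType) (A : set X) (f : Y -> set_type A) :
  continuous (fun y => set_val (f y)) -> continuous f.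
Proof. exact: (@continuous_comp_initial _ _ _ (set_val : A -> X)). Qed.

Lemma continuous_set_val (X : topologicalType) (A : set X) :
  continuous (set_val : A -> X).
Proof. exact: initial_continuous. Qed.

End CompactQuotient.

(** * Geometric realizations *)

Definition supp (R : realType) (V : finType) (x : V -> R) : {set V} :=
  [set v | x v != 0]%SET.

Definition downclosed (V : finType) (K : {set {set V}}) :=
  forall s t : {set V}, t \in K -> s \subset t -> s \in K.

Definition bary (R : realType) (V : finType) (K : {set {set V}})
  (x : realization R K) (v : V) : R := (set_val x : V -> R) v.

Section Realization.
Context {R : realType} {V : finType} (K : {set {set V}}).

Lemma in_supp (x : V -> R) v : (v \in supp x) = (x v != 0).
Proof. by rewrite inE. Qed.

Lemma bary_ge0 (x : realization R K) v : 0 <= bary x v.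
Proof. by have [+ _ _] := set_valP x; apply. Qed.

Lemma bary_sum (x : realization R K) : \sum_v bary x v = 1.
Proof. by have [] := set_valP x. Qed.

Lemma supp_bary (x : realization R K) : supp (bary x) \in K.
Proof. by have [] := set_valP x. Qed.

Lemma bary_inj (x y : realization R K) : bary x =1 bary y -> x = y.
Proof. by move=> xy; apply: val_inj; apply/funext. Qed.

Lemma cont_bary v : continuous (fun x : realization R K => bary x v).
Proof.
move=> x; apply: (@cont_comp _ _ _ (fun x : realization R K => set_val x)
  (fun z : prod_topology (fun _ : V => R : topologicalType) => z v)).
  exact: (@proj_continuous V (fun _ => R : topologicalType) v).
exact: continuous_set_val.
Qed.

Lemma bary_gt0_ex (x : realization R K) : exists v, 0 < bary x v.
Proof.
apply/not_existsP => H; have := bary_sum x; rewrite big1 => [/esym/eqP|v _].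
  by rewrite oner_eq0.
by apply/eqP; rewrite eq_le bary_ge0 andbT leNgt; exact/negP.
Qed.

Lemma continuous_bary (X : topologicalType) (f : X -> realization R K) :
  (forall v, continuous (fun x => bary (f x) v)) -> continuous f.
Proof.
move=> cf; apply: continuous_set_type => x.
apply/cvg_sup => v U [_ [[W oW <-] Wx WU]].
have : nbhs x ((fun x => bary (f x) v) @^-1` W).
  by apply: cf; exact: open_nbhs_nbhs.
by apply: filterS => y Wy; exact: WU.
Qed.

(** Barycentric coordinates before division by their sum. The division preserves supports, on which
    all later face conditions depend. *)
Definition raw_map (X : topologicalType) (F : X -> V -> R) :=
  [/\ forall v, continuous (F^~ v), forall x v, 0 <= F x v,
      forall x, exists v, 0 < F x v & forall x, supp (F x) \in K].

Lemma raw_map_normalize (X : topologicalType) (F : X -> V -> R) : raw_map F ->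
  exists2 f : X -> realization R K, continuous f
    & forall x, exists2 c, 0 < c & forall v, bary (f x) v = c * F x v.
Proof.
move=> [cF F0 Fex FK].
have S0 x : 0 < \sum_v F x v.
  have [v Fv] := Fex x; rewrite (bigD1 v)//= ltr_pwDl//.
  by apply: sumr_ge0 => u _.
have Hf x : realization_set K (fun v => (\sum_v F x v)^-1 * F x v).
  split => [v||].
  - by rewrite mulr_ge0// invr_ge0 ltW.
  - by rewrite -mulr_sumr mulVf// gt_eqF.
  - rewrite (_ : [set v | _]%SET = supp (F x))//.
    by apply/setP => v; rewrite !inE mulf_eq0 invr_eq0 gt_eqF.
exists (fun x => SigSub (mem_set (Hf x)) : realization R K).
  apply: continuous_bary => v.
  rewrite (_ : (fun x => _) = fun x => (\sum_v F x v)^-1 * F x v)//.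
  apply: contM => //; apply: contV => [x|]; first by rewrite gt_eqF.
  by apply: cont_sum => u _; exact: cF.
by move=> x; exists (\sum_v F x v)^-1 => //; rewrite invr_gt0.
Qed.

Lemma raw_map_supp (X : topologicalType) (F : X -> V -> R) : raw_map F ->
  exists2 f : X -> realization R K, continuous f
    & forall x, supp (bary (f x)) = supp (F x).
Proof.
move=> /raw_map_normalize[f cf fE]; exists f => // x.
have [c c0 fxE] := fE x.
by apply/setP => v; rewrite !inE fxE mulf_eq0 gt_eqF.
Qed.

Hypothesis dK : downclosed K.

(** A convex combination is supported in the union of the two supports. Recording this bound along
    the path shows later that a subcomplex stays invariant. *)
Lemma line_homotopy (X : topologicalType) (f g : X -> realization R K) :
  continuous f -> continuous g ->
  (forall x, supp (bary (f x)) :|: supp (bary (g x)) \in K) ->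
  homotopic_in R
    (fun x y => supp (bary y) \subset supp (bary (f x)) :|: supp (bary (g x))) f g.
Proof.
move=> cf cg fgK.
pose F (z : X * R) v := (1 - clamp01 z.2) * bary (f z.1) v + clamp01 z.2 * bary (g z.1) v.
have F0 z v : 0 <= F z v.
  by rewrite addr_ge0// mulr_ge0 ?bary_ge0 ?clamp01_ge0// subr_ge0 clamp01_le1.
have F1 z : \sum_v F z v = 1.
  by rewrite big_split/= -!mulr_sumr !bary_sum !mulr1 subrK.
have Fs z : supp (F z) \subset supp (bary (f z.1)) :|: supp (bary (g z.1)).
  apply/fintype.subsetP => v; rewrite !inE -negb_and; apply: contra => /andP[/eqP fv /eqP gv].
  by rewrite /F fv gv !mulr0 addr0.
have HF z : realization_set K (F z) by split => //; exact: dK (fgK z.1) (Fs z).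
exists (fun z => SigSub (mem_set (HF z)) : realization R K); split.
- apply: continuous_bary => v.
  have cfst : continuous (@fst X R) by move=> z; exact: cvg_fst.
  have ct : continuous (fun z : X * R => clamp01 z.2).
    by apply: cont_clamp01 => z; exact: cvg_snd.
  have cc (h : X -> realization R K) : continuous h ->
      continuous (fun z : X * R => bary (h z.1) v).
    move=> ch; apply: (@cont_comp _ _ _ (fun z : X * R => h z.1) _ (@cont_bary v)).
    exact: (cont_comp ch cfst).
  apply: contD; apply: contM; rewrite ?cc//.
  + by apply: contD; [exact: cont_cst|exact: contN].
  + exact: cc.
  + exact: cc.
- move=> x; apply: bary_inj => v; rewrite /bary set_valE /= /F clamp01_0//=.
  by rewrite subr0 mul1r mul0r addr0.
- move=> x; apply: bary_inj => v; rewrite /bary set_valE /= /F clamp01_1//=.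
  by rewrite subrr mul1r mul0r add0r.
- by move=> x t; exact: Fs (x, t).
Qed.

(** The realization is a finite union of closed simplices inside a cube; downward closure ensures
    that each simplex comes with its boundary. *)
Lemma compact_realization : compact [set: realization R K].
Proof.
apply: compact_set_type.
pose T : topologicalType := prod_topology (fun _ : V => R : topologicalType).
have cpr v : continuous (fun z : T => z v).
  exact: (@proj_continuous V (fun _ => R : topologicalType) v).
have cl (h : T -> R) (D : set R) : continuous h -> closed D -> closed [set z | D (h z)].
  by move=> /continuous_closedP ch cD; exact: ch.
pose C (s : {set V}) : set T := [set x | [/\ forall v, 0 <= x v, \sum_v x v = 1 &
  forall v, v \notin s -> x v = 0]].
have cC s : closed (C s).
  rewrite (_ : C s = (\bigcap_(v in [set: V]) [set x | 0 <= x v]) `&`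
     [set x | \sum_v x v = 1] `&` \bigcap_(v in [set v | v \notin s]) [set x | x v = 0]).
    apply: closedI; first apply: closedI.
    - by apply: closed_bigI => v _; exact: (cl _ [set t | 0 <= t] (cpr v) (@closed_ge _ _)).
    - apply: (cl _ [set t | t = 1]); last exact: closed_eq.
      by apply: cont_sum => v _; exact: cpr.
    - by apply: closed_bigI => v _; exact: (cl _ [set t | t = 0] (cpr v) (@closed_eq _ _)).
  apply/seteqP; split => x.
    by move=> [x0 x1 xs]; split; [split => // v _; exact: x0|move=> v /= vs; exact: xs].
  by move=> [[x0 x1] xs]; split => [v||v vs]; [exact: x0|exact: x1|exact: xs].
have cube : @compact T [set x : V -> R | forall v, [set` `[0, 1]] (x v)].
  apply: (@tychonoff V (fun _ => R : topologicalType) (fun _ => [set` `[0, 1]])) => v.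
  exact: segment_compact.
apply: subclosed_compact cube _.
- rewrite (_ : realization_set K = \bigcup_(s in [set` K]) C s).
    by apply: closed_bigcup => [|s _]; [exact: finite_finset|exact: cC].
  apply/seteqP; split => x /=.
    move=> [x0 x1 xK]; exists [set v | x v != 0]%SET => //; split => // v.
    by rewrite inE negbK => /eqP.
  move=> [s sK [x0 x1 xs]]; split => //; apply: (dK sK).
  by apply/fintype.subsetP => v; rewrite inE; apply: contraR => /xs ->.
- move=> x [x0 x1 _] v /=; rewrite in_itv /= x0/= -x1 (bigD1 v)//= lerDl.
  by apply: sumr_ge0 => u _; exact: x0.
Qed.

End Realization.

(** * Invariance under renaming of the vertices *)

Section Relabel.
Context {R : realType} (V W : finType) (phi : V -> W) (psi : W -> V).
Context (K : {set {set V}}) (L : {set {set W}}).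
Hypotheses (phiK : cancel phi psi) (psiK : cancel psi phi).
Hypothesis KL : forall s : {set V}, (s \in K) = (phi @: s \in L).

Lemma hequiv_relabel : @hequiv R (realization R K) (realization R L).
Proof.
have L1 (x : realization R K) : realization_set L (fun w => bary x (psi w)).
  split => [w||]; first exact: bary_ge0.
    rewrite -(bary_sum x) (reindex psi)//.
    by exists phi => ? _; rewrite ?phiK ?psiK.
  rewrite (_ : [set w | _]%SET = phi @: supp (bary x)) -?KL ?supp_bary//.
  apply/setP => w; rewrite inE; apply/idP/imsetP => [xw|[v + ->]].
    by exists (psi w); rewrite ?inE// psiK.
  by rewrite inE phiK.
have L2 (y : realization R L) : realization_set K (fun v => bary y (phi v)).
  split => [w||]; first exact: bary_ge0.
    rewrite -(bary_sum y) (reindex phi)//.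
    by exists psi => ? _; rewrite ?phiK ?psiK.
  rewrite KL (_ : _ @: _ = supp (bary y)) ?supp_bary//.
  apply/setP => w; rewrite [RHS]inE; apply/imsetP/idP => [[v + ->]|yw].
    by rewrite inE.
  by exists (psi w); rewrite ?inE psiK.
pose f x : realization R L := SigSub (mem_set (L1 x)).
pose g y : realization R K := SigSub (mem_set (L2 y)).
exists f, g; split.
- by apply: continuous_bary => w; exact: (@cont_bary _ _ K (psi w)).
- by apply: continuous_bary => v; exact: (@cont_bary _ _ L (phi v)).
- rewrite (_ : g \o f = id); first by apply: homotopic_in_refl => // x; exact: cvg_id.
  apply/funext => x; apply: bary_inj => v.
  by rewrite /bary set_valE /= /bary set_valE /= phiK.
- rewrite (_ : f \o g = id); first by apply: homotopic_in_refl => // x; exact: cvg_id.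
  apply/funext => x; apply: bary_inj => v.
  by rewrite /bary set_valE /= /bary set_valE /= psiK.
Qed.

End Relabel.

(** * The open triangle and the sphere *)

Section Stereographic.
Context {R : realType}.
Implicit Types a b c : R.

Definition tri_min a b c := Num.min a (Num.min b c).
Definition tri_dist a b c := (a - b) ^+ 2 + (a - c) ^+ 2 + (1 - a - b - c) ^+ 2.

(* Inverse stereographic projection of (a - b, a - c) / min(a, b, c), which maps
   the open triangle with barycentric coordinates a, b, c onto the plane. The
   last term of [tri_dist] vanishes on the triangle and keeps the denominator
   nonzero elsewhere. *)
Definition tri_sphere a b c : 'rV[R]_3 :=
  let h := tri_min a b c in let D := tri_dist a b c in
  \row_i ([:: D - h ^+ 2; 2 * h * (a - b); 2 * h * (a - c)]`_i / (D + h ^+ 2)).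

Lemma tri_minP a b c : 
  [/\ tri_min a b c <= a, tri_min a b c <= b, tri_min a b c <= c &
     [\/ tri_min a b c = a, tri_min a b c = b | tri_min a b c = c]].
Proof.
rewrite /tri_min; case: (leP b c) => bc; [case: (leP a b)|case: (leP a c)] => ab.
all: split => //; try lra.
all: by first [exact: Or31|exact: Or32|exact: Or33].
Qed.

Lemma tri_den_gt0 a b c : 0 < tri_dist a b c + tri_min a b c ^+ 2.
Proof.
have [_ _ _ mE] := tri_minP a b c; rewrite /tri_dist.
rewrite lt0r !addr_ge0 ?sqr_ge0// andbT !paddr_eq0 ?addr_ge0 ?sqr_ge0// !sqrf_eq0.
apply/negP => /andP[/andP[/andP[/eqP ab /eqP ac] /eqP s] /eqP h0].
by rewrite h0 in mE; case: mE; lra.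
Qed.

(** With h the minimum and D the distance term, this is (D - h^2)^2 + 4 h^2 D = (D + h^2)^2. The
    last two coordinates account for all of D only when a + b + c = 1, unless h = 0. *)
Lemma tri_sphereP a b c : 
  tri_min a b c = 0 \/ a + b + c = 1 -> sphere (tri_sphere a b c).
Proof.
move=> H; have := tri_den_gt0 a b c; rewrite /sphere /= !big_ord_recl big_ord0 !mxE /=.
move: H; rewrite /tri_dist; move: (tri_min a b c) => h H D0.
have {}D0 := lt0r_neq0 D0.
rewrite !expr_div_n addr0 -!mulrDl.
apply: (canLR (mulfK _)); rewrite ?mul1r ?expf_neq0//.
by case: H => H; [rewrite H; ring|have -> : c = 1 - a - b by [lra]; ring].
Qed.

Lemma tri_sphere_base a b c : tri_min a b c = 0 ->
  tri_sphere a b c = delta_mx ord0 ord0.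
Proof.
move=> h0; have D0 := lt0r_neq0 (tri_den_gt0 a b c).
apply/rowP => i; rewrite !mxE h0 expr0n /= subr0 addr0 mulr0 !mul0r.
rewrite h0 expr0n addr0 in D0.
by case: i => -[|[|[|//]]] /= _; rewrite ?divff ?mul0r.
Qed.

Lemma tri_sphere_min0 a b c : tri_sphere a b c = delta_mx ord0 ord0 ->
  tri_min a b c = 0.
Proof.
move=> /rowP/(_ ord0); rewrite !mxE /= => H.
have D0 := lt0r_neq0 (tri_den_gt0 a b c).
move: H => /(canRL (mulfVK D0)); rewrite mul1r => H.
apply/eqP; rewrite -sqrf_eq0; apply/eqP; lra.
Qed.

(** Since h is the minimum, a - h is the maximum of 0, a - b and a - c. The planar point (v, w) thus
    determines the triple up to the scale h. *)
Lemma tri_recover a b c h v w : 0 < h -> h <= a -> h <= b -> h <= c ->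
  [\/ h = a, h = b | h = c] -> a - b = h * v -> a - c = h * w ->
  a = h * (1 + Num.max 0 (Num.max v w)).
Proof.
move=> h0 ha hb hc hE ab ac.
have le x y : (x <= y) = (h * x <= h * y) by rewrite ler_pM2l.
have vw : (v <= w) = (c <= b) by rewrite le -ab -ac; apply/idP/idP; lra.
have v0 : (0 <= v) = (b <= a) by rewrite le mulr0 -ab; apply/idP/idP; lra.
have w0 : (0 <= w) = (c <= a) by rewrite le mulr0 -ac; apply/idP/idP; lra.
rewrite mulrDr mulr1.
case: (leP v w); rewrite ?ltNge vw => bc.
  case: (leP 0 w); rewrite ?ltNge w0 => ca; rewrite ?mulr0 -?ac.
    by case: hE => hE; lra.
  by case: hE => hE; lra.
case: (leP 0 v); rewrite ?ltNge v0 => ba; rewrite ?mulr0 -?ab.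
  by case: hE => hE; lra.
by case: hE => hE; lra.
Qed.

Lemma tri_sphere_inj a b c a' b' c' :
  0 < tri_min a b c -> 0 < tri_min a' b' c' ->
  a + b + c = 1 -> a' + b' + c' = 1 ->
  tri_sphere a b c = tri_sphere a' b' c' -> [/\ a = a', b = b' & c = c'].
Proof.
move=> h0 h0' s s' /rowP E.
have := E ord0; have := E (inord 1); have := E (inord 2).
rewrite !mxE !inordK//= {E} /tri_dist.
have D0 := tri_den_gt0 a b c; have D0' := tri_den_gt0 a' b' c'.
have [ma mb mc mE] := tri_minP a b c; have [ma' mb' mc' mE'] := tri_minP a' b' c'.
move: D0 D0'; rewrite /tri_dist.
have -> : 1 - a - b - c = 0 by lra.
have -> : 1 - a' - b' - c' = 0 by lra.
rewrite !(expr0n _ 2) !addr0 /=.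
move: (tri_min a b c) (tri_min a' b' c') h0 h0' ma mb mc mE ma' mb' mc' mE'.
move=> h h' h0 h0' ma mb mc mE ma' mb' mc' mE'.
set L : R := _ + h ^+ 2; set L' : R := _ + h' ^+ 2 => L0 L0'.
have nL : L != 0 by rewrite gt_eqF.
have nL' : L' != 0 by rewrite gt_eqF.
have nh : h != 0 by rewrite gt_eqF.
have nh' : h' != 0 by rewrite gt_eqF.
move=> E2 E1 E0.
(* The first coordinate is 1 - 2 h^2 / L; dividing the other two by this ratio recovers the planar
   point. *)
have e0 : h ^+ 2 / L = h' ^+ 2 / L'.
  have aux (D k : R) : D + k ^+ 2 != 0 ->
      (D - k ^+ 2) / (D + k ^+ 2) = 1 - 2 * (k ^+ 2 / (D + k ^+ 2)).
    by move=> ?; field.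
  by move: E0; rewrite /L /L' !aux//; lra.
have key (d d' : R) : 2 * h * d / L = 2 * h' * d' / L' -> d / h = d' / h'.
  move=> e; have -> : d / h = (2 * h * d / L) / (2 * (h ^+ 2 / L)) by field; rewrite nh nL.
  by rewrite e e0; field; rewrite nh' nL'.
have u1 := key _ _ E1; have u2 := key _ _ E2.
have f1 : a - b = h * ((a - b) / h) by field.
have f2 : a - c = h * ((a - c) / h) by field.
have f1' : a' - b' = h' * ((a' - b') / h') by field.
have f2' : a' - c' = h' * ((a' - c') / h') by field.
rewrite -u1 in f1'; rewrite -u2 in f2'.
move: ((a - b) / h) ((a - c) / h) f1 f2 f1' f2' => v w f1 f2 f1' f2'.
have ra := tri_recover h0 ma mb mc mE f1 f2.
have ra' := tri_recover h0' ma' mb' mc' mE' f1' f2'.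
move: (Num.max 0 _) ra ra' => M ra ra'.
(* The remaining scale is fixed by a + b + c = 1. *)
have hs : h * (3 + 3 * M - v - w) = 1 by nra.
have hs' : h' * (3 + 3 * M - v - w) = 1 by nra.
have nz : 3 + 3 * M - v - w != 0.
  by apply/eqP => z; move: hs; rewrite z mulr0 => /esym/eqP; rewrite oner_eq0.
have hh : h = h' by apply: (mulIf nz); rewrite hs hs'.
by rewrite -hh in ra' f1' f2'; split; nra.
Qed.

Lemma tri_sphere_surj (y : 'rV[R]_3) : sphere y -> y != delta_mx ord0 ord0 ->
  exists a b c, [/\ 0 < tri_min a b c, a + b + c = 1 & tri_sphere a b c = y].
Proof.
rewrite /sphere /= !big_ord_recl big_ord0 addr0.
set y0 := y ord0 ord0; set y1 := y _ (lift _ _); set y2 := y _ (lift _ (lift _ _)).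
move=> ys yn.
have yE (z : 'rV[R]_3) : z ord0 ord0 = y0 -> z ord0 (lift ord0 ord0) = y1 ->
    z ord0 (lift ord0 (lift ord0 ord0)) = y2 -> z = y.
  move=> z0 z1 z2; apply/rowP => i.
  have [->//|i0] := eqVneq i ord0.
  have [->//|i1] := eqVneq i (lift ord0 ord0).
  have -> : i = lift ord0 (lift ord0 ord0).
    by apply/val_inj; case: i i0 i1 => -[|[|[|//]]].
  exact: z2.
have y01 : y0 != 1.
  apply: contra_neq yn => e; have : y1 ^+ 2 + y2 ^+ 2 = 0 by nra.
  move=> /eqP; rewrite paddr_eq0 ?sqr_ge0// !sqrf_eq0 => /andP[/eqP e1 /eqP e2].
  by apply/esym/yE; rewrite !mxE /= ?e ?e1 ?e2.
have n1 : 1 - y0 != 0 by rewrite subr_eq0 eq_sym.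
(* (v, w) is the stereographic projection of [y] from the base point; the scale [h] below is the one
   forced by a + b + c = 1. *)
pose v := y1 / (1 - y0); pose w := y2 / (1 - y0); pose M := Num.max 0 (Num.max v w).
have Mv : v <= M by rewrite /M !le_max lexx orbT.
have Mw : w <= M by rewrite /M !le_max lexx !orbT.
have M0 : 0 <= M by rewrite /M !le_max lexx.
have ME : [\/ M = 0, M = v | M = w].
  rewrite /M; case: (leP v w) => _; case: leP => _; 
    by first [exact: Or31|exact: Or32|exact: Or33].
have S0 : 0 < 3 + 3 * M - v - w by lra.
pose h := (3 + 3 * M - v - w)^-1.
have h0 : 0 < h by rewrite invr_gt0.
have hS : h * (3 + 3 * M - v - w) = 1 by rewrite mulVf// gt_eqF.
pose a := h * (1 + M); pose b := h * (1 + M - v); pose c := h * (1 + M - w).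
have hE : tri_min a b c = h.
  have [ma mb mc mE] := tri_minP a b c.
  apply/le_anti/andP; split; last by rewrite /a /b /c in mE; case: mE => ->; nra.
  by rewrite /a /b /c in ma mb mc *; case: ME => ME; rewrite ME in ma mb mc *; nra.
exists a, b, c; rewrite hE; split => //; first by rewrite /a /b /c; nra.
have DE : tri_dist a b c = h ^+ 2 * (v ^+ 2 + w ^+ 2).
  have s1 : 1 - a - b - c = 0 by rewrite /a /b /c; nra.
  by rewrite /tri_dist s1 /a /b /c; ring.
have vw : v ^+ 2 + w ^+ 2 + 1 = 2 / (1 - y0).
  rewrite /v /w !expr_div_n -mulrDl.
  have -> : y1 ^+ 2 + y2 ^+ 2 = 1 - y0 ^+ 2 by lra.
  by field.
have nvw : v ^+ 2 + w ^+ 2 + 1 != 0 by rewrite vw mulf_neq0 ?invr_eq0 ?pnatr_eq0.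
have nh : h != 0 by rewrite gt_eqF.
have den : tri_dist a b c + h ^+ 2 = h ^+ 2 * (v ^+ 2 + w ^+ 2 + 1) by rewrite DE; ring.
apply: yE; rewrite !mxE /= hE den.
- have -> : tri_dist a b c - h ^+ 2 = h ^+ 2 * ((v ^+ 2 + w ^+ 2 + 1) - 2) by rewrite DE; ring.
  by rewrite vw; field; rewrite nh n1.
- have -> : 2 * h * (a - b) = h ^+ 2 * (2 * v) by rewrite /a /b; ring.
  by rewrite vw /v; field; rewrite nh n1.
- have -> : 2 * h * (a - c) = h ^+ 2 * (2 * w) by rewrite /a /c; ring.
  by rewrite vw /w; field; rewrite nh n1.
Qed.

Lemma continuous_mx (X : topologicalType) (p q : nat) (f : X -> 'M[R]_(p, q)) :
  (forall i j, continuous (fun x => f x i j)) -> continuous f.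
Proof.
move=> cf x A [P PM PA].
have : \forall y \near x, forall i, forall j, P i j (f y i j).
  apply: filter_forall => i; apply: filter_forall => j; apply: cf; exact: PM.
by apply: filterS => y Py; exact: PA.
Qed.

Lemma cont_tri_sphere (X : topologicalType) (a b c : X -> R) :
  continuous a -> continuous b -> continuous c ->
  continuous (fun x => tri_sphere (a x) (b x) (c x)).
Proof.
move=> ca cb cc.
have cB (f g : X -> R) : continuous f -> continuous g -> continuous (fun x => f x - g x).
  by move=> cf cg; apply: contD => //; exact: contN.
have cX (f : X -> R) : continuous f -> continuous (fun x => f x ^+ 2).
  by move=> cf; under eq_fun do rewrite expr2; exact: contM.
have ch : continuous (fun x => tri_min (a x) (b x) (c x)).
  by apply: cont_min => //; exact: cont_min.
have cD : continuous (fun x => tri_dist (a x) (b x) (c x)).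
  apply: contD; first by apply: contD; apply: cX; exact: cB.
  by apply: cX; apply: (cB _ _) => //; apply: (cB _ _) => //; apply: cB => //; exact: cont_cst.
apply: continuous_mx => i j; under eq_fun do rewrite mxE.
apply: contM; last first.
  apply: contV => [x|]; first by rewrite gt_eqF ?tri_den_gt0.
  by apply: contD => //; exact: cX.
case: j => -[|[|[|//]]] ?; rewrite /=.
- by apply: cB => //; exact: cX.
- by apply: contM; [apply: contM => //; exact: cont_cst|exact: cB].
- by apply: contM; [apply: contM => //; exact: cont_cst|exact: cB].
Qed.

End Stereographic.

(** * Joins of three discrete sets *)

(* The join of discrete sets, one for each colour. *)
Definition rainbow (V : finType) (col : V -> 'I_3) : {set {set V}} :=
  [set s : {set V} | [forall u in s, forall v in s, (col u == col v) ==> (u == v)]]%SET.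

Section Rainbow.
Context {R : realType} (V : finType) (col : V -> 'I_3) (base : 'I_3 -> V).
Hypothesis colb : forall k, col (base k) = k.
Notation J := (rainbow col).

Lemma rainbowP (s : {set V}) :
  reflect (forall u v, u \in s -> v \in s -> col u = col v -> u = v) (s \in J).
Proof.
rewrite inE; apply: (iffP forall_inP) => [H u v us vs cuv|H u us].
  by have /forall_inP/(_ v vs)/implyP/(_ (introT eqP cuv))/eqP := H u us.
by apply/forall_inP => v vs; apply/implyP => /eqP cuv; apply/eqP; exact: H.
Qed.

Lemma downclosed_rainbow : downclosed J.
Proof.
move=> s t /rainbowP tJ /fintype.subsetP st.
by apply/rainbowP => u v us vs; apply: tJ; exact: st.
Qed.

Definition nonbase v := v != base (col v).

Lemma nonbaseb k : nonbase (base k) = false.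
Proof. by rewrite /nonbase colb eqxx. Qed.

Lemma nonbaseN v : ~~ nonbase v -> v = base (col v).
Proof. by rewrite negbK => /eqP. Qed.

Definition has_nonbase (s : {set V}) k := [exists v in s, (col v == k) && nonbase v].

Lemma has_nonbaseP (s : {set V}) k :
  reflect (exists2 v, v \in s & col v = k /\ nonbase v) (has_nonbase s k).
Proof.
apply: (iffP exists_inP) => [[v vs /andP[/eqP vk vn]]|[v vs [vk vn]]]; exists v => //.
by rewrite vk eqxx.
Qed.

(** In a colour without nonbase vertices the only possible vertex is the base one, so adding it
    creates no clash. *)
Lemma rainbowU (s t : {set V}) : s \in J ->
  (forall v, v \in t -> v \in s \/ ~~ nonbase v /\ ~~ has_nonbase s (col v)) ->
  s :|: t \in J.
Proof.
move=> /rainbowP sJ ts.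
have {}ts v : v \in s :|: t -> v \in s \/ ~~ nonbase v /\ ~~ has_nonbase s (col v).
  by rewrite !inE => /orP[?|/ts//]; left.
have main u v : u \in s -> ~~ nonbase v -> ~~ has_nonbase s (col v) -> col u = col v -> u = v.
  move=> us /nonbaseN vb sn uv.
  have [un|/nonbaseN ->] := boolP (nonbase u); last by rewrite uv -vb.
  by case/negP: sn; apply/has_nonbaseP; exists u.
apply/rainbowP => u v /ts[us|[ub un]] /ts[vs|[vb vn]] uv.
- exact: sJ.
- exact: main.
- by apply/esym/main.
- by rewrite (nonbaseN ub) (nonbaseN vb) uv.
Qed.

Lemma rainbowU_cross (s t : {set V}) : s \in J -> t \in J ->
  (forall u v, u \in s -> v \in t -> col u = col v -> u = v) -> s :|: t \in J.
Proof.
move=> /rainbowP sJ /rainbowP tJ st; apply/rainbowP => u v; rewrite !inE.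
move=> /orP[us|ut] /orP[vs|vt] uv; [exact: sJ|exact: st| |exact: tJ].
by apply/esym/st.
Qed.

Implicit Types y : V -> R.

Definition mass y k := \sum_(v | (col v == k) && nonbase v) y v.
Definition other_sum y k := \sum_(l | l != k) mass y l.
Definition other_prod y k := \prod_(l | l != k) mass y l.
(** Plays the part of the distance to the subcomplex to be collapsed: it vanishes exactly when some
    colour has no nonbase vertex. *)
Definition min_mass y := Num.min (mass y ord0) (Num.min (mass y (inord 1)) (mass y (inord 2))).

Lemma mass_ge0 y k : (forall v, 0 <= y v) -> 0 <= mass y k.
Proof. by move=> y0; apply: sumr_ge0. Qed.

Lemma mass_gt0 y k : (forall v, 0 <= y v) -> (0 < mass y k) = has_nonbase (supp y) k.
Proof.
move=> y0; apply/idP/has_nonbaseP => [|[v]].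
  rewrite lt0r psumr_neq0// => /andP[/hasP[v _ /andP[/andP[/eqP vk vn] yv]] _].
  by exists v => //; rewrite inE gt_eqF.
rewrite inE => yv [vk vn]; rewrite /mass (bigD1 v) ?vk ?eqxx//= ltr_pwDl//.
  by rewrite lt0r yv y0.
by apply: sumr_ge0.
Qed.

Lemma mass_eq0 y k : (forall v, 0 <= y v) -> (mass y k == 0) = ~~ has_nonbase (supp y) k.
Proof. by move=> y0; rewrite -mass_gt0// lt0r mass_ge0// andbT negbK. Qed.

(** A rainbow support has at most one vertex of each colour, so the mass is zero or a single
    coordinate. *)
Lemma mass_le y k (c : R) : (forall v, 0 <= y v) -> supp y \in J -> 0 <= c ->
  (forall v, col v = k -> nonbase v -> y v <= c) -> mass y k <= c.
Proof.
move=> y0 /rainbowP yJ c0 yc.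
have [/has_nonbaseP[v vs [vk vn]]|] := boolP (has_nonbase (supp y) k); last first.
  by rewrite -mass_eq0// => /eqP ->.
rewrite /mass (bigD1 v) ?vk ?eqxx//= big1 ?addr0 ?yc// => u /andP[/andP[/eqP uk un] uv].
apply/eqP; apply: contraNT uv => yu; apply/eqP/yJ; rewrite ?inE ?uk ?vk//.
by rewrite inE in vs.
Qed.

Lemma mass_ge y v : (forall v, 0 <= y v) -> nonbase v -> y v <= mass y (col v).
Proof.
move=> y0 vn; rewrite /mass (bigD1 v) ?eqxx//= lerDl.
by apply: sumr_ge0.
Qed.

Lemma other_sum_ge0 y k : (forall v, 0 <= y v) -> 0 <= other_sum y k.
Proof. by move=> y0; apply: sumr_ge0 => l _; exact: mass_ge0. Qed.

Lemma other_sum_gt0 y k : (forall v, 0 <= y v) -> 0 < other_sum y k ->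
  exists2 l, l != k & has_nonbase (supp y) l.
Proof.
move=> y0; rewrite lt0r psumr_neq0 => [|l _]; last exact: mass_ge0.
move=> /andP[/hasP[l _ /andP[lk ml]] _]; exists l => //.
by rewrite -mass_gt0.
Qed.

Lemma other_sum_ge y k l : (forall v, 0 <= y v) -> l != k -> mass y l <= other_sum y k.
Proof.
move=> y0 lk; rewrite /other_sum (bigD1 l)//= lerDl.
by apply: sumr_ge0 => i _; exact: mass_ge0.
Qed.

Lemma other_prod_ge0 y k : (forall v, 0 <= y v) -> 0 <= other_prod y k.
Proof. by move=> y0; apply: prodr_ge0 => l _; exact: mass_ge0. Qed.

Lemma other_prod_gt0 y k : (forall v, 0 <= y v) ->
  (0 < other_prod y k) = [forall l, (l != k) ==> has_nonbase (supp y) l].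
Proof.
move=> y0; apply/idP/forallP => [p0 l|H]; last first.
  by apply: prodr_gt0 => l lk; rewrite mass_gt0//; exact: (implyP (H l)).
apply/implyP => lk; rewrite -mass_gt0// lt0r mass_ge0// andbT.
by apply: contraTneq p0 => l0; rewrite /other_prod (bigD1 l)//= l0 mul0r ltxx.
Qed.

Lemma ord3_cases (k : 'I_3) : [\/ k = ord0, k = inord 1 | k = inord 2].
Proof.
by case: k => -[|[|[|//]]] kP; [apply: Or31|apply: Or32|apply: Or33];
   apply: val_inj => //=; rewrite inordK.
Qed.

Lemma min_mass_le y k : min_mass y <= mass y k.
Proof.
by rewrite /min_mass; case: (ord3_cases k) => ->; rewrite !ge_min lexx ?orbT.
Qed.

Lemma min_massE y : exists k, min_mass y = mass y k.
Proof.
rewrite /min_mass; case: (leP (mass y (inord 1)) _) => _.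
  by case: (leP (mass y ord0) _) => _; [exists ord0|exists (inord 1)].
by case: (leP (mass y ord0) _) => _; [exists ord0|exists (inord 2)].
Qed.

Lemma min_mass_ge0 y : (forall v, 0 <= y v) -> 0 <= min_mass y.
Proof. by move=> y0; have [k ->] := min_massE y; exact: mass_ge0. Qed.

Lemma min_mass_gt0 y : (forall v, 0 <= y v) ->
  (0 < min_mass y) = [forall k, has_nonbase (supp y) k].
Proof.
move=> y0; apply/idP/forallP => [m0 k|H].
  by rewrite -mass_gt0//; apply: lt_le_trans m0 _; exact: min_mass_le.
by have [k ->] := min_massE y; rewrite mass_gt0.
Qed.

Lemma sum_mass y : \sum_v y v = \sum_k mass y k + \sum_k y (base k).
Proof.
rewrite (bigID nonbase)/=; congr (_ + _).
  rewrite (partition_big col xpredT)//=; apply: eq_bigr => k _.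
  by apply: eq_bigl => v; rewrite andbC.
rewrite (reindex_onto base col) => [|v vb]; last by rewrite -nonbaseN.
by apply: eq_bigl => k; rewrite nonbaseb colb eqxx.
Qed.

Lemma third_colour (k l : 'I_3) : k != l ->
  exists2 i, i != k /\ i != l & forall j, j != i -> j = k \/ j = l.
Proof.
case: k l => [[|[|[|//]]] ?] [[|[|[|//]]] ?] // _;
  [exists (@Ordinal 3 2 isT)|exists (@Ordinal 3 1 isT)|exists (@Ordinal 3 2 isT)
  |exists (@Ordinal 3 0 isT)|exists (@Ordinal 3 1 isT)|exists (@Ordinal 3 0 isT)] => //;
  case=> [[|[|[|//]]] ?] // _;
  by first [left; exact: val_inj|right; exact: val_inj].
Qed.

End Rainbow.

(** * Extending the contraction of the defective subcomplex to the join *)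

Section RainbowDeformation.
Context {R : realType} (V : finType) (col : V -> 'I_3) (base : 'I_3 -> V).
Hypothesis colb : forall k, col (base k) = k.
Notation J := (rainbow col).
Notation X := (realization R J).
Notation nonbase := (nonbase col base).
Notation mass := (mass col base).
Notation other_sum := (other_sum col base).
Notation other_prod := (other_prod col base).
Notation min_mass := (min_mass col base).
Notation has_nonbase := (has_nonbase col base).

Let h (x : X) := min_mass (bary x).
(** The ramp from 1 down to 0 occupies [c - 1/12, c]. The thresholds 1/12, 1/6 and 1/4 used below
    are consecutive multiples of its width, and the largest is below 1/3, which keeps [push0] from
    vanishing. *)
Let theta (c : R) (x : X) := clamp01 (12 * (c - h x)).

(* Near the defective points, where [h] vanishes, [push0] lands in them, [push1]
   leaves nonbase vertices of at most one colour, [push2] moves into the base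
   triangle and [push3] onto a base vertex. Each [theta] is 1 wherever the next
   one is nonzero. *)
Let push0 (x : X) v : R :=
  if nonbase v then Num.max 0 (bary x v - Num.min (h x) (1/4)) else bary x v.
Let push1 (x : X) v : R := let y := push0 x in
  if nonbase v then Num.max 0 (y v - theta (1/4) x * other_sum y (col v))
  else y v + theta (1/4) x * other_prod y (col v).
Let push2 (x : X) v : R := let y := push1 x in
  if nonbase v then (1 - theta (1/6) x) * y v
  else y v + theta (1/6) x * other_sum y (col v).
Let push3 (x : X) v : R :=
  (1 - theta (1/12) x) * push2 x v + theta (1/12) x * (v == base ord0)%:R.

Let theta_ge0 c x : 0 <= theta c x. Proof. exact: clamp01_ge0. Qed.
Let theta_le1 c x : 0 <= 1 - theta c x. Proof. by rewrite subr_ge0 clamp01_le1. Qed.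

Let h_ge0 x : 0 <= h x. Proof. by apply: min_mass_ge0; exact: bary_ge0. Qed.

Let theta_gt0 c x : theta c x != 0 -> h x < c.
Proof.
move=> t0; have /clamp01_gt0 : 0 < theta c x by rewrite lt0r t0 theta_ge0.
by rewrite pmulr_rgt0// subr_gt0.
Qed.

Let theta_eq1 c x : h x <= c - 1/12 -> theta c x = 1.
Proof. by move=> hc; apply: clamp01_1; lra. Qed.

Let push0_ge0 x v : 0 <= push0 x v.
Proof. by rewrite /push0; case: ifP => _; rewrite ?le_max ?lexx// bary_ge0. Qed.

Let push1_ge0 x v : 0 <= push1 x v.
Proof.
rewrite /push1; case: ifP => _; first by rewrite le_max lexx.
by rewrite addr_ge0// mulr_ge0// other_prod_ge0.
Qed.

Let push2_ge0 x v : 0 <= push2 x v.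
Proof.
rewrite /push2; case: ifP => _; first by rewrite mulr_ge0.
by rewrite addr_ge0// mulr_ge0// other_sum_ge0.
Qed.

Let push3_ge0 x v : 0 <= push3 x v.
Proof. by rewrite addr_ge0// mulr_ge0// ler0n. Qed.

Let supp0 x : supp (push0 x) \subset supp (bary x).
Proof.
apply/fintype.subsetP => v; rewrite !inE /push0; case: ifP => // _; apply: contra => /eqP ->.
by rewrite max_l// sub0r oppr_le0 le_min h_ge0; lra.
Qed.

Let supp0J x : supp (push0 x) \in J.
Proof. exact: downclosed_rainbow (supp_bary x) (supp0 x). Qed.

(** The colour of least mass is wiped out, as each of its nonbase coordinates is at most that mass
    [h x]. *)
Let push0_defect x : h x <= 1/4 -> exists k, ~~ has_nonbase (supp (push0 x)) k.
Proof.
move=> h4; have [k hk] := min_massE col base (bary x); exists k.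
apply/has_nonbaseP => -[v]; rewrite inE => + [vk vn]; rewrite /push0 vn => /eqP; apply.
rewrite max_l// subr_le0 min_l// /h hk.
apply: le_trans (mass_ge _ vn) _; first exact: bary_ge0.
by rewrite vk.
Qed.

Let push0_ex x : exists v, 0 < push0 x v.
Proof.
apply/not_existsP => H.
have H0 v : push0 x v = 0 by apply/le_anti; rewrite push0_ge0 leNgt andbT; exact/negP.
have := bary_sum x; rewrite (sum_mass colb) [X in _ + X]big1 => [|k _]; last first.
  by have := H0 (base k); rewrite /push0 nonbaseb.
(* If everything vanished, the whole weight 1 would lie in three masses of at most 1/4. *)
have M4 k : mass (bary x) k <= 1/4.
  apply: mass_le; [exact: bary_ge0|exact: supp_bary|lra|].
  move=> v vk vn; have := H0 v; rewrite /push0 vn => /eqP.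
  rewrite eq_le ge_max => /andP[/andP[_ +] _]; rewrite subr_le0 => /le_trans; apply.
  by rewrite ge_min lexx orbT.
rewrite !big_ord_recl big_ord0.
move: (M4 ord0) (M4 (lift ord0 ord0)) (M4 (lift ord0 (lift ord0 ord0))).
lra.
Qed.

Let nonbase1 x v : nonbase v -> push1 x v != 0 -> push0 x v != 0.
Proof.
move=> vn; rewrite /push1 vn; apply: contra => /eqP ->.
by rewrite max_l// sub0r oppr_le0 mulr_ge0// other_sum_ge0.
Qed.

(** A base vertex gains weight only if both other colours carry nonbase mass. Some colour carries
    none after [push0], so it is the colour of that base vertex. *)
Let supp01 x : supp (push0 x) :|: supp (push1 x) \in J.
Proof.
have [t0|/theta_gt0 h4] := eqVneq (theta (1/4) x) 0.
  suff -> : supp (push1 x) = supp (push0 x) by rewrite finset.setUid supp0J.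
  apply/setP => v; rewrite !inE /push1 t0 !mul0r subr0 addr0.
  by case: ifP => // _; rewrite max_r.
apply: (rainbowU (base := base)) => // v; rewrite in_supp.
have [vn pv|vb] := boolP (nonbase v); first by left; rewrite inE nonbase1.
have [pv|pv _] := eqVneq (push0 x v) 0; last by left; rewrite inE.
rewrite /push1 (negbTE vb) pv add0r mulf_eq0 negb_or => /andP[_] pp; right; split => //.
have : 0 < other_prod (push0 x) (col v) by rewrite lt0r pp other_prod_ge0.
rewrite other_prod_gt0// => /forallP H.
have [k nk] := push0_defect (ltW h4).
have [<-//|kv] := eqVneq k (col v).
by have := implyP (H k) kv; rewrite (negbTE nk).
Qed.

Let supp1J x : supp (push1 x) \in J.
Proof. by apply: downclosed_rainbow (supp01 x) _; exact: finset.subsetUr. Qed.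

Let push1_ex x : exists v, 0 < push1 x v.
Proof.
have [v pv] := push0_ex x.
have [vn|vb] := boolP (nonbase v); last first.
  exists v; rewrite /push1 (negbTE vb) ltr_pwDl// mulr_ge0//.
  exact: other_prod_ge0.
have [pos|] := ltP 0 (push1 x v); first by exists v.
rewrite {1}/push1 vn ge_max lexx /= subr_le0 => le.
have : 0 < theta (1/4) x * other_sum (push0 x) (col v) by exact: lt_le_trans le.
rewrite lt0r mulf_eq0 negb_or => /andP[/andP[t0 os] _].
have /(other_sum_gt0 (push0_ge0 x))[l lv lN] : 0 < other_sum (push0 x) (col v).
  by rewrite lt0r os other_sum_ge0.
(* The nonbase vertex [v] can be erased only by mass of another colour [l]; together they feed the
   base vertex of the third colour. *)
have [i [il iv] Hi] := third_colour lv.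
exists (base i); rewrite /push1 nonbaseb// colb ltr_wpDl//.
rewrite mulr_gt0 ?lt0r ?t0//= -lt0r other_prod_gt0//.
apply/forallP => k; apply/implyP => /Hi[->//|->].
by apply/has_nonbaseP; exists v => //; rewrite inE gt_eqF.
Qed.

(** Here the damping factor of [push1] is 1, so a surviving coordinate exceeds the mass of all other
    colours together. Two colours cannot both achieve this. *)
Let push1_single x u v : theta (1/6) x != 0 -> nonbase u -> nonbase v ->
  push1 x u != 0 -> push1 x v != 0 -> col u = col v.
Proof.
move=> /theta_gt0 h6 un vn; rewrite /push1 un vn (theta_eq1 (c := 1/4)) ?mul1r; last by lra.
have pos (a : R) : Num.max 0 a != 0 -> 0 < a.
  by apply: contraNT; rewrite -leNgt => ?; rewrite max_l.
move=> /pos + /pos; rewrite !subr_gt0 => pu pv.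
apply/eqP; apply: contraT => uv.
have := lt_le_trans pv (mass_ge (push0_ge0 x) vn).
have := lt_le_trans pu (mass_ge (push0_ge0 x) un).
have := other_sum_ge col base (push0_ge0 x) uv.
rewrite eq_sym in uv; have := other_sum_ge col base (push0_ge0 x) uv.
lra.
Qed.

Let nonbase2 x v : nonbase v -> push2 x v != 0 -> push1 x v != 0.
Proof. by move=> vn; rewrite /push2 vn mulf_eq0 negb_or => /andP[]. Qed.

(** A base vertex gains weight only from nonbase mass of another colour, and by [push1_single] its
    own colour then has none. *)
Let supp12 x : supp (push1 x) :|: supp (push2 x) \in J.
Proof.
have [t0|tn] := eqVneq (theta (1/6) x) 0.
  suff -> : supp (push2 x) = supp (push1 x) by rewrite finset.setUid supp1J.
  apply/setP => v; rewrite !inE /push2 t0 !mul0r subr0 addr0 mul1r.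
  by case: ifP.
apply: (rainbowU (base := base)) => // v; rewrite in_supp.
have [vn pv|vb] := boolP (nonbase v); first by left; rewrite inE nonbase2.
have [pv|pv _] := eqVneq (push1 x v) 0; last by left; rewrite inE.
rewrite /push2 (negbTE vb) pv add0r mulf_eq0 negb_or => /andP[_] pp; right; split => //.
have /(other_sum_gt0 (push1_ge0 x))[l lv /has_nonbaseP[u us [ul un]]] :
  0 < other_sum (push1 x) (col v) by rewrite lt0r pp other_sum_ge0.
apply/has_nonbaseP => -[w ws [wv wn]].
by move: lv; rewrite -ul -wv (@push1_single x u w) ?eqxx// -in_supp.
Qed.

Let supp2J x : supp (push2 x) \in J.
Proof. by apply: downclosed_rainbow (supp12 x) _; exact: finset.subsetUr. Qed.

Let push2_ex x : exists v, 0 < push2 x v.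
Proof.
have [v pv] := push1_ex x.
have [vn|vb] := boolP (nonbase v); last first.
  exists v; rewrite /push2 (negbTE vb) ltr_pwDl// mulr_ge0//.
  exact: other_sum_ge0.
have [t1|t1] := eqVneq (theta (1/6) x) 1; last first.
  by exists v; rewrite /push2 vn mulr_gt0// lt0r theta_le1 subr_eq0 eq_sym t1.
have [k kv] : exists k, k != col v.
  by have [->|v0] := eqVneq (col v) ord0; [exists ord_max|exists ord0; rewrite eq_sym].
exists (base k); rewrite /push2 nonbaseb// t1 mul1r ltr_wpDl// colb.
apply: lt_le_trans (other_sum_ge col base (push1_ge0 x) _); last by rewrite eq_sym; exact: kv.
exact: lt_le_trans pv (mass_ge (push1_ge0 x) vn).
Qed.

Let nonbase3 x v : nonbase v -> push3 x v != 0 -> push2 x v != 0.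
Proof.
move=> vn; rewrite /push3; have -> : (v == base ord0) = false.
  by apply/negbTE; apply: contraTneq vn => ->; rewrite nonbaseb.
by rewrite mulr0 addr0 mulf_eq0 negb_or => /andP[].
Qed.

Let supp23 x : supp (push2 x) :|: supp (push3 x) \in J.
Proof.
have [t0|tn] := eqVneq (theta (1/12) x) 0.
  suff -> : supp (push3 x) = supp (push2 x) by rewrite finset.setUid supp2J.
  by apply/setP => v; rewrite !inE /push3 t0 mul0r subr0 addr0 mul1r.
(* Where [push3] acts, [push2] has already erased every nonbase vertex, and base vertices always
   span a face. *)
have t1 : theta (1/6) x = 1 by apply: theta_eq1; move: (theta_gt0 tn); lra.
apply: (rainbowU (base := base)) => // v; rewrite in_supp.
have [vn pv|vb _] := boolP (nonbase v); first by left; rewrite inE nonbase3.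
right; split => //; apply/has_nonbaseP => -[w + [_ wn]].
by rewrite inE /push2 wn t1 subrr mul0r eqxx.
Qed.

Let supp3J x : supp (push3 x) \in J.
Proof. by apply: downclosed_rainbow (supp23 x) _; exact: finset.subsetUr. Qed.

Let push3_ex x : exists v, 0 < push3 x v.
Proof.
have [t1|t1] := eqVneq (theta (1/12) x) 1.
  by exists (base ord0); rewrite /push3 t1 subrr mul0r add0r mul1r eqxx.
have [v pv] := push2_ex x; exists v.
by rewrite ltr_pwDl ?mulr_ge0 ?ler0n// mulr_gt0// lt0r theta_le1 subr_eq0 eq_sym t1.
Qed.

Let cont_mass (F : X -> V -> R) k : (forall v, continuous (F^~ v)) ->
  continuous (fun x => mass (F x) k).
Proof. by move=> cF; apply: cont_sum => v _; exact: cF. Qed.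

Let cont_other_sum (F : X -> V -> R) k : (forall v, continuous (F^~ v)) ->
  continuous (fun x => other_sum (F x) k).
Proof. by move=> cF; apply: cont_sum => v _; exact: cont_mass. Qed.

Let cont_other_prod (F : X -> V -> R) k : (forall v, continuous (F^~ v)) ->
  continuous (fun x => other_prod (F x) k).
Proof. by move=> cF; apply: cont_prod => v _; exact: cont_mass. Qed.

Let cont_h : continuous h.
Proof.
have cm k : continuous (fun x : X => mass (bary x) k).
  by apply: cont_mass => v; exact: cont_bary.
by apply: cont_min => //; exact: cont_min.
Qed.

Let cont_theta c : continuous (theta c).
Proof.
apply: cont_clamp01; apply: contM; first exact: cont_cst.
by apply: contD; [exact: cont_cst|exact: contN].
Qed.

Let cont_push0 v : continuous (push0^~ v).
Proof.
rewrite /push0; case: (nonbase v); last exact: cont_bary.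
apply: cont_max; first exact: cont_cst.
apply: contD; first exact: cont_bary.
by apply: contN; apply: cont_min => //; exact: cont_cst.
Qed.

Let cont_push1 v : continuous (push1^~ v).
Proof.
rewrite /push1 ; case: (nonbase v).
  apply: cont_max; first exact: cont_cst.
  by apply: contD => //; apply: contN; apply: contM => //; exact: cont_other_sum.
by apply: contD => //; apply: contM => //; exact: cont_other_prod.
Qed.

Let cont_push2 v : continuous (push2^~ v).
Proof.
rewrite /push2 ; case: (nonbase v).
  by apply: contM => //; apply: contD; [exact: cont_cst|exact: contN].
by apply: contD => //; apply: contM => //; exact: cont_other_sum.
Qed.

Let cont_push3 v : continuous (push3^~ v).
Proof.
apply: contD; apply: contM => //; last exact: cont_cst.
by apply: contD; [exact: cont_cst|exact: contN].
Qed.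

Definition defective (x : X) := min_mass (bary x) = 0.

(** Every stage of the deformation only uses nonbase vertices already present in [x], so this keeps
    the subcomplex invariant. *)
Let defective_sub (x y : X) :
  (forall v, nonbase v -> v \in supp (bary y) -> v \in supp (bary x)) ->
  defective x -> defective y.
Proof.
move=> xy dx; apply/eqP; rewrite eq_le min_mass_ge0 ?andbT; last exact: bary_ge0.
rewrite leNgt min_mass_gt0; last exact: bary_ge0.
have : ~~ (0 < min_mass (bary x)) by rewrite dx ltxx.
rewrite min_mass_gt0; last exact: bary_ge0.
apply: contra => /forallP H; apply/forallP => k.
have /has_nonbaseP[v vs [vk vn]] := H k.
by apply/has_nonbaseP; exists v => //; exact: xy.
Qed.

Lemma rainbow_deformation : exists e : X -> X,
  homotopic_in R (fun x y => defective x -> defective y) id e /\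
  forall x x', defective x -> defective x' -> e x = e x'.
Proof.
have [f0 c0 s0] := @raw_map_supp R V J X push0 (And4 cont_push0 push0_ge0 push0_ex supp0J).
have [f1 c1 s1] := @raw_map_supp R V J X push1 (And4 cont_push1 push1_ge0 push1_ex supp1J).
have [f2 c2 s2] := @raw_map_supp R V J X push2 (And4 cont_push2 push2_ge0 push2_ex supp2J).
have [f3 c3 s3] := @raw_map_supp R V J X push3 (And4 cont_push3 push3_ge0 push3_ex supp3J).
have n0 x v : nonbase v -> v \in supp (push0 x) -> v \in supp (bary x).
  by move=> _; move: (supp0 x) => /fintype.subsetP; exact.
have n1 x v : nonbase v -> v \in supp (push1 x) -> v \in supp (bary x).
  by move=> vn vs; apply: n0 => //; move: vs; rewrite !inE; exact: nonbase1.
have n2 x v : nonbase v -> v \in supp (push2 x) -> v \in supp (bary x).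
  by move=> vn vs; apply: n1 => //; move: vs; rewrite !inE; exact: nonbase2.
have n3 x v : nonbase v -> v \in supp (push3 x) -> v \in supp (bary x).
  by move=> vn vs; apply: n2 => //; move: vs; rewrite !inE; exact: nonbase3.
have step (f g : X -> X) : continuous f -> continuous g ->
    (forall x, supp (bary (f x)) :|: supp (bary (g x)) \in J) ->
    (forall x v, nonbase v -> v \in supp (bary (f x)) -> v \in supp (bary x)) ->
    (forall x v, nonbase v -> v \in supp (bary (g x)) -> v \in supp (bary x)) ->
    homotopic_in R (fun x y => defective x -> defective y) f g.
  move=> cf cg fgJ nf ng.
  apply: homotopic_in_sub (line_homotopy (@downclosed_rainbow _ col) cf cg fgJ) => x y sub.
  apply: defective_sub => v vn /(fintype.subsetP sub); rewrite finset.in_setU.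
  by move=> /orP[]; [exact: nf|exact: ng].
exists f3; split.
  apply: (@homotopic_in_trans _ _ _ _ _ f0).
    apply: (step) => //.
    - by move=> x; exact: cvg_id.
    - by move=> x; rewrite s0 (finset.setUidPl (supp0 x)) supp_bary.
    - by move=> x v; rewrite s0; exact: n0.
  apply: (@homotopic_in_trans _ _ _ _ _ f1).
    apply: (step) => // [x|x v|x v]; rewrite ?s0 ?s1//.
    - exact: n0.
    - exact: n1.
  apply: (@homotopic_in_trans _ _ _ _ _ f2).
    apply: (step) => // [x|x v|x v]; rewrite ?s1 ?s2//.
    - exact: n1.
    - exact: n2.
  apply: (step) => // [x|x v|x v]; rewrite ?s2 ?s3//.
  - exact: n2.
  - exact: n3.
have bE x : defective x -> forall v, bary (f3 x) v = (v == base ord0)%:R.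
  move=> dx.
  have t1 : theta (1/12) x = 1 by apply: theta_eq1; rewrite /h dx; lra.
  have z v : v != base ord0 -> bary (f3 x) v = 0.
    move=> vb; apply/eqP; apply: contraNT vb => vn.
    have : v \in supp (bary (f3 x)) by rewrite inE.
    rewrite s3 inE /push3 t1 subrr mul0r add0r mul1r.
    by case: (v == base ord0) => //=; rewrite eqxx.
  move=> v; case: eqVneq => [->|/z//].
  by rewrite -(bary_sum (f3 x)) (bigD1 (base ord0))//= big1 ?addr0.
by move=> x x' dx dx'; apply: bary_inj => v; rewrite !bE.
Qed.

End RainbowDeformation.

(** * The quotient of the join as a wedge of spheres *)

Section RainbowWedge.
Context {R : realType} (V : finType) (col : V -> 'I_3) (base : 'I_3 -> V).
Hypothesis colb : forall k, col (base k) = k.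
Context (m : nat) (cell : 'I_m -> 'I_3 -> V) (j0 : 'I_m).
Hypothesis col_cell : forall j k, col (cell j k) = k.
Hypothesis nonbase_cell : forall j k, nonbase col base (cell j k).
Hypothesis cell_inj : forall i j, cell i =1 cell j -> i = j.
Hypothesis cell_surj : forall u : 'I_3 -> V,
  (forall k, col (u k) = k /\ nonbase col base (u k)) -> exists j, cell j =1 u.
Notation J := (rainbow col).
Notation X := (realization R J).
Notation pt := (sphere_point R 2).
Notation W := (wedge_of_spheres R 2 m).

Let k0 : 'I_3 := ord0.
Let k1 : 'I_3 := inord 1.
Let k2 : 'I_3 := inord 2.

Let cell_min (j : 'I_m) (x : X) :=
  tri_min (bary x (cell j k0)) (bary x (cell j k1)) (bary x (cell j k2)).

Let k01 : k0 != k1. Proof. by rewrite -val_eqE /= inordK. Qed.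

Let cell_min_ge0 j x : 0 <= cell_min j x.
Proof. by rewrite /cell_min /tri_min !le_min !bary_ge0. Qed.

Let cell_min_gt0 j x : 0 < cell_min j x -> forall k, 0 < bary x (cell j k).
Proof.
rewrite /cell_min /tri_min !lt_min => /andP[p0 /andP[p1 p2]] k.
by case: (ord3_cases k) => ->.
Qed.

Let bary_cell j x v : 0 < cell_min j x -> v != cell j (col v) -> bary x v = 0.
Proof.
move=> /cell_min_gt0 H; apply: contraNeq => xv; apply/eqP.
move/rainbowP: (supp_bary x); apply; rewrite ?inE ?col_cell//.
by rewrite gt_eqF.
Qed.

Let cell_sum j x : 0 < cell_min j x ->
  bary x (cell j k0) + bary x (cell j k1) + bary x (cell j k2) = 1.
Proof.
move=> H; rewrite -(bary_sum x) (bigID (fun v => v == cell j (col v)))/=.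
rewrite [Y in _ = _ + Y]big1 ?addr0 => [|v]; last exact: bary_cell.
rewrite (reindex_onto (cell j) col) => [|v /eqP/esym//].
rewrite (eq_bigl xpredT) => [|k]; last by rewrite !col_cell !eqxx.
rewrite !big_ord_recl big_ord0 /= addr0 addrA; congr (_ + bary x (cell j _) + bary x (cell j _)).
  by apply: val_inj; rewrite /= inordK.
by apply: val_inj; rewrite /= inordK.
Qed.

Let cell_min_uniq i j x : 0 < cell_min i x -> 0 < cell_min j x -> i = j.
Proof.
move=> Hi Hj; apply: cell_inj => k; apply/eqP; apply: contraT => ij.
have := cell_min_gt0 Hi k; rewrite (@bary_cell j) ?ltxx//.
by rewrite col_cell.
Qed.

Let defectiveP x : defective base x <-> forall j, cell_min j x = 0.
Proof.
split=> [dx j|H].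
  apply/eqP; rewrite eq_le cell_min_ge0 andbT leNgt; apply/negP => /cell_min_gt0 H.
  have : 0 < min_mass col base (bary x).
    rewrite min_mass_gt0; last exact: bary_ge0.
    apply/forallP => k; apply/has_nonbaseP; exists (cell j k) => //.
    by rewrite inE gt_eqF.
  by rewrite dx ltxx.
apply/eqP; rewrite eq_le min_mass_ge0 ?andbT; last exact: bary_ge0.
rewrite leNgt min_mass_gt0; last exact: bary_ge0.
apply/negP => /forallP full.
have /choice[u Hu] : forall k, exists v, [/\ v \in supp (bary x), col v = k & nonbase col base v].
  by move=> k; have /has_nonbaseP[v vs [vk vn]] := full k; exists v.
have [|j ju] := cell_surj (u := u); first by move=> k; have [] := Hu k.
have := H j; suff : 0 < cell_min j x by move=> + e; rewrite e ltxx.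
have p k : 0 < bary x (cell j k).
  by rewrite ju lt0r bary_ge0 andbT; have [] := Hu k; rewrite inE.
by rewrite /cell_min /tri_min !lt_min !p.
Qed.

Let cell_sphereP j (x : X) : sphere
  (tri_sphere (bary x (cell j k0)) (bary x (cell j k1)) (bary x (cell j k2))).
Proof.
apply: tri_sphereP; have [z|n0] := eqVneq (cell_min j x) 0; first by left.
by right; apply: cell_sum; rewrite lt0r n0 cell_min_ge0.
Qed.

Let cell_map j (x : X) : set_type (@sphere R 2) := SigSub (mem_set (cell_sphereP j x)).

Let cell_map_pt j x : cell_min j x = 0 -> cell_map j x = pt.
Proof. by move=> h; apply: val_inj => /=; exact: tri_sphere_base. Qed.

Let cell_map_ptE j x : cell_map j x = pt -> cell_min j x = 0.
Proof. by move=> /(congr1 val) /= /tri_sphere_min0. Qed.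

Let cont_cell_map j : continuous (cell_map j).
Proof.
apply: continuous_set_type.
have -> : (fun x => set_val (cell_map j x)) = fun x : X =>
  tri_sphere (bary x (cell j k0)) (bary x (cell j k1)) (bary x (cell j k2)) by [].
by apply: cont_tri_sphere; exact: cont_bary.
Qed.

Let lift j : set_type (@sphere R 2) -> W :=
  @wedge_lift _ (fun _ : 'I_m => set_type (@sphere R 2)) (fun=> pt) j.

Let lift_pt i j : lift i pt = lift j pt.
Proof. exact: (@wedge_liftE _ (fun _ : 'I_m => set_type (@sphere R 2)) (fun=> pt) j pt i pt). Qed.

(** The retraction of the wedge onto its k-th sphere. It recovers [cell_map k] from [q], which
    yields the injectivity of [q] off the subcomplex. *)
Let proj_cell k : W -> set_type (@sphere R 2) :=
  @wedge_fun _ (fun _ : 'I_m => set_type (@sphere R 2)) (fun=> pt) _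
    (fun i y => if i == k then y else pt).

Let proj_lift k i y : proj_cell k (lift i y) = if i == k then y else pt.
Proof. by rewrite /proj_cell wedge_lift_funE// => i' j'; do 2 case: ifP. Qed.

(** At most one cell minimum is positive, so the pick is unambiguous. Points in no open cell go to
    the base point, named here through [j0]. *)
Let q (x : X) : W :=
  if [pick j | 0 < cell_min j x] is Some j then lift j (cell_map j x) else lift j0 pt.

Let qE j x : (forall i, i != j -> cell_min i x = 0) -> q x = lift j (cell_map j x).
Proof.
move=> H; rewrite /q; case: pickP => [i i0|none].
  by have [->//|/H i0'] := eqVneq i j; rewrite i0' ltxx in i0.
rewrite cell_map_pt ?(lift_pt j0 j)//.
by apply/eqP; rewrite eq_le cell_min_ge0 andbT leNgt none.
Qed.

Let only_cell x : exists j, forall i, i != j -> cell_min i x = 0.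
Proof.
have [/existsP[j hj]|/existsPn none] := boolP [exists j, 0 < cell_min j x].
  exists j => i; apply: contraNeq => hi; apply/eqP/(@cell_min_uniq i j x) => //.
  by rewrite lt0r hi cell_min_ge0.
by exists j0 => i _; apply/eqP; rewrite eq_le cell_min_ge0 andbT leNgt none.
Qed.

Let proj_q k x : proj_cell k (q x) = cell_map k x.
Proof.
have [j H] := only_cell x; rewrite (qE H) proj_lift.
by case: eqVneq => [->//|jk]; rewrite cell_map_pt// H// eq_sym.
Qed.

Let cont_cell_min j : continuous (cell_min j).
Proof. by apply: cont_min; [|apply: cont_min]; exact: cont_bary. Qed.

Let cont_q : continuous q.
Proof.
(* The j-th closed piece consists of the points in no open cell other than j; where two pieces
   overlap, everything goes to the base point. *)
apply: (@closed_pasting _ _ _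
  (fun j => \bigcap_(i in [set i | i != j]) [set x | cell_min i x = 0])
  (fun j x => lift j (cell_map j x))).
- move=> j; apply: closed_bigI => i _.
  have /continuous_closedP/(_ [set t | t = 0] (@closed_eq _ _)) := @cont_cell_min i.
  exact.
- move=> j; apply: cont_comp (@cont_cell_map j).
  exact: (@wedge_lift_continuous _ (fun _ : 'I_m => set_type (@sphere R 2)) (fun=> pt) j).
- by move=> x; have [j H] := only_cell x; exists j => i; exact: H.
- by move=> j x H; apply: qE => i; exact: H.
Qed.

Let cell_point j (t : 'I_3 -> R) : (forall k, 0 <= t k) -> \sum_k t k = 1 ->
  exists x : X, forall v, bary x v = (v == cell j (col v))%:R * t (col v).
Proof.
move=> t0 t1.
have H : realization_set J (fun v => (v == cell j (col v))%:R * t (col v)).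
  split => [v||]; first by rewrite mulr_ge0.
    rewrite (bigID (fun v => v == cell j (col v)))/= [Y in _ + Y]big1 ?addr0; last first.
      by move=> v /negbTE ->; rewrite mul0r.
    rewrite (reindex_onto (cell j) col) => [|v /eqP/esym//].
    rewrite -[RHS]t1; apply: eq_big => k; first by rewrite !col_cell !eqxx.
    by move=> _; rewrite col_cell eqxx mul1r.
  apply/rainbowP => u v; rewrite !inE.
  have [-> _|_] := eqVneq u; last by rewrite mul0r eqxx.
  have [-> _|_] := eqVneq v; last by rewrite mul0r eqxx.
  by rewrite !col_cell => ->.
by exists (SigSub (mem_set H)) => v.
Qed.

Let q_surj w : exists x, q x = w.
Proof.
have : [set: W] w by [].
rewrite -(@wedgeTE _ (fun _ : 'I_m => set_type (@sphere R 2)) (fun=> pt)) => -[j _ [y _ <-]].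
pose bumpE := (col_cell, eqxx, mul1r).
(* The base point is the image of a vertex of the cell [j0]: its coordinate of colour [k1] vanishes
   on every cell. *)
have [->|yn] := eqVneq y pt.
  have [||x xE] := @cell_point j0 (fun k => (k == ord0)%:R).
  - by move=> k; rewrite ler0n.
  - by rewrite (bigD1 ord0)//= big1 ?addr0// => k /negbTE ->.
  exists x; suff H i : cell_min i x = 0.
    by rewrite (@qE j0)// cell_map_pt// (lift_pt j0 j).
  apply/eqP; rewrite eq_le cell_min_ge0 andbT /cell_min /tri_min !ge_min.
  by rewrite (xE (cell i k1)) col_cell [k1 == _]eq_sym (negbTE k01) mulr0 lexx orbT.
have [||a [b [c [h abc yE]]]] := @tri_sphere_surj R (val y).
- by have := set_valP y.
- by apply: contra_neq yn => e; exact: val_inj.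
pose t (k : 'I_3) := [:: a; b; c]`_k.
have [a0 b0 c0 _] := tri_minP a b c.
have [||x xE] := @cell_point j t.
- by move=> k; rewrite /t; case: k => -[|[|[|//]]] ? /=; apply/ltW/(lt_le_trans h).
- by rewrite !big_ord_recl big_ord0 addr0 addrA.
have x0 : bary x (cell j k0) = a by rewrite xE !bumpE.
have x1 : bary x (cell j k1) = b by rewrite xE !bumpE /t inordK.
have x2 : bary x (cell j k2) = c by rewrite xE !bumpE /t inordK.
have hj : 0 < cell_min j x by rewrite /cell_min x0 x1 x2.
exists x; rewrite (@qE j) => [|i ij].
  by congr (lift j _); apply: val_inj; rewrite /= x0 x1 x2.
apply/eqP; apply: contraNT ij => hi; apply/eqP/(@cell_min_uniq i j x) => //.
by rewrite lt0r hi cell_min_ge0.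
Qed.

Lemma rainbow_wedge : @hequiv R X W.
Proof.
have [e [He ec]] := @rainbow_deformation R V col base colb.
apply: (@hequiv_quotient R X W (defective base) q e) => //.
- exact: compact_realization (@downclosed_rainbow _ col).
- apply: wedge_hausdorff => _; apply: hausdorff_set_type.
  exact: norm_hausdorff.
- move=> x x' qq.
  have E k : cell_map k x = cell_map k x' by rewrite -!proj_q qq.
  have [/existsP[j hj]|/existsPn none] := boolP [exists j, 0 < cell_min j x]; last first.
    right; have z k : cell_min k x = 0.
      by apply/eqP; rewrite eq_le cell_min_ge0 andbT leNgt none.
    split; apply/defectiveP => // k.
    by apply: cell_map_ptE; rewrite -E cell_map_pt.
  left; have hj' : 0 < cell_min j x'.
    rewrite lt0r cell_min_ge0 andbT; apply: contraTneq hj => z.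
    by rewrite (@cell_map_ptE j x) ?ltxx// E cell_map_pt.
  have [e0 e1 e2] := tri_sphere_inj hj hj' (cell_sum hj) (cell_sum hj') (congr1 val (E j)).
  apply: bary_inj => v; have [->|vn] := eqVneq v (cell j (col v)); last first.
    by rewrite !(@bary_cell j).
  by case: (ord3_cases (col v)) => ->.
- move=> x x' /defectiveP H /defectiveP H'.
  by rewrite !(@qE j0)// !cell_map_pt.
Qed.

End RainbowWedge.

(** Indexes the cells by any finite type; [0 < m] supplies the cell through which the base point is
    named. *)
Lemma rainbow_wedge_fin (R : realType) (V : finType) (col : V -> 'I_3)
    (base : 'I_3 -> V) (T : finType) (cell : T -> 'I_3 -> V) (m : nat) :
  (forall k, col (base k) = k) -> (0 < m)%N -> #|T| = m ->
  (forall j k, col (cell j k) = k) ->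
  (forall j k, nonbase col base (cell j k)) ->
  (forall i j, cell i =1 cell j -> i = j) ->
  (forall u : 'I_3 -> V, (forall k, col (u k) = k /\ nonbase col base (u k)) ->
     exists j, cell j =1 u) ->
  @hequiv R (realization R (rainbow col)) (wedge_of_spheres R 2 m).
Proof.
move=> colb m0 Tm cc cn ci cs.
pose f (j : 'I_m) : T := enum_val (cast_ord (esym Tm) j).
apply: (rainbow_wedge colb (cell := fun j => cell (f j)) (Ordinal m0)) => //.
- by move=> i j /ci/enum_val_inj/cast_ord_inj.
- move=> u /cs[j ju]; exists (cast_ord Tm (enum_rank j)) => k.
  by rewrite -ju /f cast_ordK enum_rankK.
Qed.

(** * The complex for even n *)

Section EvenComplex.
Context {R : realType} (n : nat).

Definition even_complex : {set {set 'I_n.+1 * bool}} :=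
  [set s : {set 'I_n.+1 * bool} |
    [exists t, exists i, forall j, ((j, t) \in s) ==> (j == i)]]%SET.

Lemma even_complexP (s : {set 'I_n.+1 * bool}) :
  reflect (exists t i, forall j, (j, t) \in s -> j = i) (s \in even_complex).
Proof.
rewrite inE; apply: (iffP existsP) => [[t /existsP[i /forallP H]]|[t [i H]]]; exists t.
  by exists i => j js; apply/eqP; exact: (implyP (H j)).
by apply/existsP; exists i; apply/forallP => j; apply/implyP => /H/eqP.
Qed.

Lemma downclosed_even : downclosed even_complex.
Proof.
move=> s u /even_complexP[t [i H]] /fintype.subsetP su.
by apply/even_complexP; exists t, i => j /su; exact: H.
Qed.

Notation VJ := (('I_n.+1 * bool) + bool)%type.

(* [inl u] is a vertex of the complex, [inr t] the centre of the simplex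
   spanned by the side [t]. *)
Definition even_col (v : VJ) : 'I_3 :=
  match v with inl u => if u.2 then ord0 else inord 1 | inr _ => inord 2 end.

Notation X := (realization R even_complex).
Notation Y := (realization R (rainbow even_col)).
Implicit Types (x : 'I_n.+1 * bool -> R) (y : VJ -> R).

Let S x t := \sum_j x (j, t).
Let P x t := \sum_j \sum_(i | i != j) x (j, t) * x (i, t).

(** A vertex keeps weight only if it carries more than half of its side, so at most one per side
    does. [P] detects two vertices on the same side, which a face has on at most one side. In the
    other direction, [gg] sends the centre of a side to its barycentre. *)
Let ff x (v : VJ) : R :=
  match v with inl u => Num.max 0 (2 * x u - S x u.2) | inr t => P x t end.
Let gg y (u : 'I_n.+1 * bool) : R := y (inl u) + y (inr u.2).

Let S_ge2 x i j t : (forall u, 0 <= x u) -> i != j -> x (i, t) + x (j, t) <= S x t.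
Proof.
move=> x0 ij; rewrite /S (bigD1 i)//= lerD2l (bigD1 j) 1?eq_sym//= lerDl.
exact: sumr_ge0.
Qed.

Let P_neq0 x t : (forall u, 0 <= x u) -> P x t != 0 ->
  exists i j, [/\ i != j, x (i, t) != 0 & x (j, t) != 0].
Proof.
move=> x0; rewrite psumr_neq0 => [|j _]; last by apply: sumr_ge0 => i _; exact: mulr_ge0.
move=> /hasP[j _ /=]; rewrite lt0r psumr_neq0 => [|i _]; last exact: mulr_ge0.
move=> /andP[/hasP[i _ /andP[ij xij]] _]; move: xij.
rewrite lt0r mulf_eq0 negb_or => /andP[/andP[xj xi] _].
by exists i, j.
Qed.

Let P_gt0 x t i j : (forall u, 0 <= x u) -> i != j -> 0 < x (i, t) -> 0 < x (j, t) -> 0 < P x t.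
Proof.
move=> x0 ij xi xj; rewrite /P (bigD1 j)//= ltr_pwDl//.
  rewrite (bigD1 i)//= ltr_pwDl ?mulr_gt0//.
  by apply: sumr_ge0 => *; exact: mulr_ge0.
by apply: sumr_ge0 => *; apply: sumr_ge0 => *; exact: mulr_ge0.
Qed.

Let ff_ge0 x v : (forall u, 0 <= x u) -> 0 <= ff x v.
Proof.
move=> x0; case: v => [u|t] /=; first by rewrite le_max lexx.
by apply: sumr_ge0 => *; apply: sumr_ge0 => *; exact: mulr_ge0.
Qed.

Let ff_inl x u : ff x (inl u) != 0 -> S x u.2 < 2 * x u.
Proof. by rewrite /= -subr_gt0; apply: contraNT; rewrite -leNgt => /max_l ->. Qed.

Let ff_inl_neq0 x u : (forall u, 0 <= x u) -> ff x (inl u) != 0 -> x u != 0.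
Proof.
move=> x0 /ff_inl H; apply: contraTneq H => ->; rewrite mulr0 -leNgt.
exact: sumr_ge0.
Qed.

Let supp_ff (x : X) : supp (ff (bary x)) \in rainbow even_col.
Proof.
have x0 := bary_ge0 x.
apply/rainbowP => -[[j t]|t] [[j' t']|t']; rewrite !in_supp => fu fv /=.
- move=> tt'; have {tt'} E : t = t'.
    by case: t t' {fu fv} tt' => -[] // /(congr1 val); rewrite /= inordK.
  rewrite -{}E in fv *; congr (inl (_, _)); apply/eqP; apply: contraT => jj'.
  by have := S_ge2 t x0 jj'; have := ff_inl fu; have := ff_inl fv => /=; lra.
- by case: ifP => _ /(congr1 val); rewrite /= ?inordK.
- by case: ifP => _ /(congr1 val); rewrite /= ?inordK.
- move=> _; congr inr; apply/eqP; apply: contraT => tt'.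
  have /even_complexP[s [i H]] := supp_bary x.
  have [k [l [kl xk xl]]] : exists k l, [/\ k != l, bary x (k, s) != 0 & bary x (l, s) != 0].
    by apply: P_neq0 => //; move: fu fv tt'; case: s t t' {H} => -[] [].
  by move: kl; rewrite (H k) ?inE// (H l) ?inE// eqxx.
Qed.

Let ff_ex (x : X) : exists v, 0 < ff (bary x) v.
Proof.
have x0 := bary_ge0 x.
have [[j t] xj] := bary_gt0_ex x.
have [/existsP[i /andP[ij xi]]|/existsPn H] := boolP [exists i, (i != j) && (0 < bary x (i, t))].
  by exists (inr t); exact: P_gt0 xi xj.
exists (inl (j, t)) => /=; rewrite lt_max; apply/orP; right.
rewrite /S (bigD1 j)//= big1 => [|i ij]; first by lra.
by have := H i; rewrite ij /= -leNgt => xi; apply/le_anti; rewrite xi x0.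
Qed.

Let cont_S t : continuous (fun x : X => S (bary x) t).
Proof. by apply: cont_sum => j _; exact: cont_bary. Qed.

Let cont_ff v : continuous (fun x : X => ff (bary x) v).
Proof.
case: v => [u|t] /=.
  apply: cont_max; first exact: cont_cst.
  apply: contD; last exact/contN/cont_S.
  by apply: contM; [exact: cont_cst|exact: cont_bary].
by apply: cont_sum => j _; apply: cont_sum => i _; apply: contM; exact: cont_bary.
Qed.

Let supp_gg (y : Y) : supp (gg (bary y)) \in even_complex.
Proof.
have /rainbowP yJ := supp_bary y.
have [t yt] : exists t, bary y (inr t) = 0.
  have [?|yt] := eqVneq (bary y (inr true)) 0; first by exists true.
  exists false; apply/eqP; apply: contraT => yf.
  by have := yJ (inr true) (inr false); rewrite !inE => /(_ yt yf erefl).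
have gE j : (j, t) \in supp (gg (bary y)) -> bary y (inl (j, t)) != 0.
  by rewrite inE /gg /= yt addr0.
apply/even_complexP; exists t.
have [[i gi]|none] := pselect (exists i, (i, t) \in supp (gg (bary y))).
  exists i => j gj; have := yJ (inl (j, t)) (inl (i, t)); rewrite !inE.
  by move=> /(_ (gE _ gj) (gE _ gi) erefl) [].
by exists ord0 => j gj; case: none; exists j.
Qed.

Let gg_ex (y : Y) : exists u, 0 < gg (bary y) u.
Proof.
have [[u|t] yv] := bary_gt0_ex y.
  by exists u; rewrite ltr_pwDl// bary_ge0.
by exists (ord0, t); rewrite /gg /= ltr_wpDl// bary_ge0.
Qed.

Lemma even_rainbow : @hequiv R X Y.
Proof.
have [f cf fE] : exists2 f : X -> Y, continuous f
    & forall x : X, exists2 c : R, 0 < c & forall v, bary (f x) v = c * ff (bary x) v.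
  apply: (@raw_map_normalize R VJ (rainbow even_col) X (fun x : X => ff (bary x))).
  split => //.
  by move=> x v; apply: ff_ge0; exact: bary_ge0.
have [g cg gE] : exists2 g : Y -> X, continuous g
    & forall y : Y, exists2 c : R, 0 < c & forall u, bary (g y) u = c * gg (bary y) u.
  apply: (@raw_map_normalize R _ even_complex Y (fun y : Y => gg (bary y))).
  split => //.
    by move=> u; apply: contD; exact: cont_bary.
  by move=> y u; rewrite addr_ge0 ?bary_ge0.
have fs (x : X) v : (bary (f x) v != 0) = (ff (bary x) v != 0).
  by have [c c0 ->] := fE x; rewrite mulf_eq0 gt_eqF.
have gs (y : Y) u : (bary (g y) u != 0) = (gg (bary y) u != 0).
  by have [c c0 ->] := gE y; rewrite mulf_eq0 gt_eqF.
exists f, g; split => //.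
- apply: homotopic_in_top; apply: line_homotopy.
  + exact: downclosed_even.
  + by move=> x; apply: continuous_comp; [exact: cf|exact: cg].
  + by move=> x; exact: cvg_id.
  + move=> x /=; have x0 := bary_ge0 x.
    (* On a side where [x] has at most one vertex the centre gets no weight, so the composite adds
       no vertex there. *)
    have /even_complexP[t [i H]] := supp_bary x.
    apply/even_complexP; exists t, i => j.
    rewrite finset.in_setU => /orP[|/H//]; rewrite in_supp gs /gg /= => gj.
    have : (bary (f x) (inl (j, t)) != 0) || (bary (f x) (inr t) != 0).
      by apply: contraTT gj; rewrite negb_or !negbK => /andP[/eqP -> /eqP ->]; rewrite addr0.
    rewrite !fs => /orP[/ff_inl_neq0 xj|/P_neq0 Pt].
      by apply: H; rewrite inE xj.
    have [//|k [l [kl xk xl]]] := Pt.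
    by move: kl; rewrite (H k) ?inE// (H l) ?inE// eqxx.
- apply: homotopic_in_top; apply: line_homotopy.
  + exact: downclosed_rainbow.
  + by move=> y; apply: continuous_comp; [exact: cg|exact: cf].
  + by move=> y; exact: cvg_id.
  + move=> y /=; have y0 := bary_ge0 y; have x0 := bary_ge0 (g y).
    have /rainbowP yJ := supp_bary y.
    apply: rainbowU_cross; [exact: supp_bary|exact: supp_bary|].
    have [c c0 gyE] := gE y.
    move=> [[j t]|t] [[j' t']|t']; rewrite !in_supp fs => fu yv.
    * move=> tt'; have {tt'} E : t = t'.
        by case: t t' {fu yv} tt' => -[] // /(congr1 val); rewrite /= inordK.
      rewrite -{}E in yv *; congr (inl (_, _)); apply/eqP; apply: contraT => jj'.
      have yj : bary y (inl (j, t)) = 0.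
        apply/eqP; apply: contraNT jj' => yj; apply/eqP.
        by have := yJ (inl (j, t)) (inl (j', t)); rewrite !inE => /(_ yj yv erefl) [].
      (* The weight of [(j, t)] in [g y] comes only from the centre, which is spread evenly over the
         side; it cannot beat [(j', t)], hence is no majority. *)
      have := S_ge2 t x0 jj'; have := ff_inl fu => /=.
      suff : bary (g y) (j, t) <= bary (g y) (j', t) by lra.
      by rewrite !gyE ler_pM2l// /gg /= yj add0r lerDr.
    * by rewrite /=; case: ifP => _ /(congr1 val); rewrite /= ?inordK.
    * by rewrite /=; case: ifP => _ /(congr1 val); rewrite /= ?inordK.
    * move=> _; congr inr; apply/eqP; apply: contraT => tt'.
      (* Without the centre [t] in [y], the image [g y] has at most one vertex on that side, so [P]
         vanishes. *)
      have yt : bary y (inr t) = 0.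
        apply/eqP; apply: contraNT tt' => yt; apply/eqP.
        by have := yJ (inr t) (inr t'); rewrite !inE => /(_ yt yv erefl) [].
      have [//|k [l [kl]]] := P_neq0 _ fu.
      rewrite !gs /gg /= yt !addr0 => yk yl.
      have := yJ (inl (k, t)) (inl (l, t)); rewrite !inE => /(_ yk yl erefl) [] E.
      by rewrite E eqxx in kl.
Qed.

(** A triangle without base vertex amounts to one of n nonbase vertices on each side, the third
    vertex being forced. *)
Lemma even_wedge : (0 < n)%N ->
  @hequiv R X (wedge_of_spheres R 2 (n ^ 2)).
Proof.
move=> n0; apply: hequiv_trans even_rainbow _.
pose vert (a b : 'I_n.+1) (t : bool) (k : 'I_3) : VJ :=
  if k == ord0 then inl (a, true) else if k == inord 1 then inl (b, false) else inr t.
have v0 a b t : vert a b t ord0 = inl (a, true) by [].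
have v1 a b t : vert a b t (inord 1) = inl (b, false).
  by rewrite /vert eqxx ifF// -val_eqE /= inordK.
have v2 a b t : vert a b t (inord 2) = inr t.
  by rewrite /vert !ifF// -val_eqE /= !inordK.
have colv a b t k : even_col (vert a b t k) = k.
  by case: (ord3_cases k) => ->; rewrite !(v0, v1, v2).
pose base := vert ord0 ord0 false.
have nbE a b k : nonbase even_col base (vert (lift ord0 a) (lift ord0 b) true k).
  by rewrite /nonbase colv /base; case: (ord3_cases k) => ->; rewrite !(v0, v1, v2).
apply: (@rainbow_wedge_fin R VJ even_col base ('I_n * 'I_n)%type
  (fun p => vert (lift ord0 p.1) (lift ord0 p.2) true)) => //.
- exact: colv.
- by rewrite expn_gt0 n0.
- by rewrite card_prod !card_ord.
- move=> [a b] [a' b'] H.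
  have := H ord0; have := H (inord 1); rewrite !(v0, v1) => -[] e1 -[] e0.
  by congr pair; exact: val_inj.
- move=> u uP.
  have [a ua] : exists a, u ord0 = inl (lift ord0 a, true).
    have [] := uP ord0; rewrite /nonbase => -> ; rewrite /base v0.
    case: (u ord0) (uP ord0).1 => [[a []]|t] /= /(congr1 val); rewrite /= ?inordK// => _.
    by case: (unliftP ord0 a) => [a' ->|->]; [exists a'|rewrite eqxx].
  have [b ub] : exists b, u (inord 1) = inl (lift ord0 b, false).
    have [] := uP (inord 1); rewrite /nonbase => -> ; rewrite /base v1.
    case: (u (inord 1)) (uP (inord 1)).1 => [[b []]|t] /= /(congr1 val); rewrite /= ?inordK// => _.
    by case: (unliftP ord0 b) => [b' ->|->]; [exists b'|rewrite eqxx].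
  have uc : u (inord 2) = inr true.
    have [] := uP (inord 2); rewrite /nonbase => -> ; rewrite /base v2.
    case: (u (inord 2)) (uP (inord 2)).1 => [[c []]|[]] //= /(congr1 val); rewrite /= ?inordK//.
  by exists (a, b) => k; case: (ord3_cases k) => ->; rewrite !(v0, v1, v2).
Qed.

End EvenComplex.

(** * The complex for odd n *)

Section OddComplex.
Context {R : realType} (n : nat).
Hypothesis n2 : (2 <= n)%N.
Notation VK := ('I_n.+1 * bool)%type.

(** Adding [(ord_max, t)] or [(ord0, ~~ t)] preserves this condition, so the faces satisfying it for
    a fixed [t] form a cone. Both ends of the rung [i] are allowed; a face satisfying it for both
    values of [t] lies in one side or in one rung. *)
Definition staircase (t : bool) (s : {set VK}) :=
  [exists i : 'I_n.+1, forall j : 'I_n.+1,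
    (((j, t) \in s) ==> (i <= j)%N) && (((j, ~~ t) \in s) ==> (j <= i)%N)].

Definition odd_complex : {set {set VK}} :=
  [set s : {set VK} | [exists t, staircase t s]]%SET.

Lemma staircaseP t (s : {set VK}) :
  reflect (exists i : 'I_n.+1, forall j : 'I_n.+1,
    ((j, t) \in s -> (i <= j)%N) /\ ((j, ~~ t) \in s -> (j <= i)%N)) (staircase t s).
Proof.
apply: (iffP existsP) => [[i /forallP H]|[i H]]; exists i.
  by move=> j; have /andP[/implyP ? /implyP ?] := H j.
by apply/forallP => j; have [? ?] := H j; apply/andP; split; exact/implyP.
Qed.

Lemma odd_complexP (s : {set VK}) : reflect (exists t, staircase t s) (s \in odd_complex).
Proof. by rewrite inE; exact: existsP. Qed.

Lemma downclosed_odd : downclosed odd_complex.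
Proof.
move=> s u /odd_complexP[t /staircaseP[i H]] /fintype.subsetP su.
apply/odd_complexP; exists t; apply/staircaseP; exists i => j.
by have [H1 H2] := H j; split => /su.
Qed.

Notation VJ := ((bool + 'I_n.+1) + bool)%type.

(* [inl (inl t)] stands for the simplex spanned by the side [t], [inl (inr i)]
   for the middle of the rung [i], and [inr t] for an apex of the subcomplex of
   the faces satisfying [staircase t]. *)
Definition odd_col (v : VJ) : 'I_3 :=
  match v with inl (inl _) => ord0 | inl (inr _) => inord 1 | inr _ => inord 2 end.

Notation X := (realization R odd_complex).
Notation Y := (realization R (rainbow odd_col)).

Let S (x : VK -> R) t := \sum_j x (j, t).
(** Positive when some vertex of the side [t] lies strictly above one of the other side, which is
    the obstruction to [staircase (~~ t)]. *)
Let P (x : VK -> R) t := \sum_(j < n.+1) \sum_(i < n.+1 | (i < j)%N) x (j, t) * x (i, ~~ t).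
Let mid (x : VK -> R) i := Num.min (x (i, true)) (x (i, false)).

Let ff (x : VK -> R) (v : VJ) : R :=
  match v with
  | inl (inl t) => Num.max 0 (S x t - S x (~~ t))
  | inl (inr i) => mid x i
  | inr t => P x t
  end.

(** A rung different from the first and the last, available because there are at least three. *)
Let star : 'I_n.+1 := inord 1.
Let ctot (y : VJ -> R) := \sum_i y (inl (inr i)).
Let ntot (y : VJ -> R) := y (inr true) + y (inr false).

(** The middle of a rung goes to both its ends, the pole [t] to [(star, t)], and the apex [t] to the
    cone points [(ord_max, t)] and [(ord0, ~~ t)]. The truncated differences make a growing pole [t]
    first push the rung onto its end on the side [t]; only then does [star] appear, so it never
    meets the opposite end. *)
Let gg (y : VJ -> R) (u : VK) : R :=
  Num.max 0 (y (inl (inr u.1)) - y (inl (inl (~~ u.2))))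
  + (u.1 == star)%:R * Num.max 0 (y (inl (inl u.2)) - ctot y - ntot y)
  + (u.1 == ord_max)%:R * y (inr u.2) + (u.1 == ord0)%:R * y (inr (~~ u.2)).

(* Erases the smaller side once it is small enough. This is an intermediate stage
   between the identity and the composite through the join, whose supports need
   not span a common face. *)
Let rr (x : VK -> R) (u : VK) : R :=
  x u * Num.max 0 (S x u.2 + (ctot (ff x) + ntot (ff x)) - S x (~~ u.2)).

Let max0_neq0 (a : R) : Num.max 0 a != 0 -> 0 < a.
Proof. by apply: contraNT; rewrite -leNgt => ?; rewrite max_l. Qed.

Section Nonneg.
Context (x : VK -> R) (x0 : forall u, 0 <= x u).

Lemma odd_S_ex t : S x t != 0 -> exists j, 0 < x (j, t).
Proof. by rewrite psumr_neq0// => /hasP[j _ /= xj]; exists j. Qed.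

Let P_ge0 t : 0 <= P x t.
Proof. by apply: sumr_ge0 => *; apply: sumr_ge0 => *; exact: mulr_ge0. Qed.

Let P_neq0 t : P x t != 0 ->
  exists i j : 'I_n.+1, [/\ (i < j)%N, x (j, t) != 0 & x (i, ~~ t) != 0].
Proof.
rewrite psumr_neq0 => [|j _]; last by apply: sumr_ge0 => i _; exact: mulr_ge0.
move=> /hasP[j _ /=]; rewrite lt0r psumr_neq0 => [|i _]; last exact: mulr_ge0.
move=> /andP[/hasP[i _ /andP[ij xij]] _]; move: xij.
rewrite lt0r mulf_eq0 negb_or => /andP[/andP[xj xi] _].
by exists i, j.
Qed.

Lemma odd_P_staircase t : staircase t (supp x) -> P x (~~ t) = 0.
Proof.
move=> /staircaseP[k H]; apply/eqP; apply: contraT => /P_neq0[i [j [ij xj xi]]].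
have [_] := H j; rewrite inE xj => /(_ isT) jk.
have [+ _] := H i; rewrite inE -{1}[t]negbK xi => /(_ isT) ki.
by have := leq_ltn_trans (leq_trans jk ki) ij; rewrite ltnn.
Qed.

Lemma odd_ff_ge0 v : 0 <= ff x v.
Proof.
case: v => [[t|i]|t] /=; first by rewrite le_max lexx.
  by rewrite le_min !x0.
exact: P_ge0.
Qed.

Lemma odd_mid_neq0 i : mid x i != 0 -> forall t, x (i, t) != 0.
Proof.
move=> m0 t; have : 0 < mid x i by rewrite lt0r m0 le_min !x0.
by rewrite lt_min => /andP[? ?]; case: t; rewrite gt_eqF.
Qed.

(** The two pole weights are opposite differences, cut off at 0; a rung with both ends in a
    staircase must be the cutting rung; and on a staircase one of the two [P] vanishes. *)
Lemma odd_supp_ff : supp x \in odd_complex -> supp (ff x) \in rainbow odd_col.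
Proof.
move=> /odd_complexP[s sx]; apply/rainbowP => u v; rewrite !in_supp.
case: u v => [[t|i]|t] [[t'|i']|t'] fu fv /= E;
  try by move/(congr1 val): E; rewrite /= ?inordK.
- congr (inl (inl _)); apply/eqP; apply: contraT => tt'; move: fu fv => /=.
  have -> : t' = ~~ t by case: t t' tt' => -[].
  by rewrite negbK => /max0_neq0 + /max0_neq0; lra.
- congr (inl (inr _)); move/staircaseP: sx => [k H].
  have key j : mid x j != 0 -> j = k.
    move=> /odd_mid_neq0 xj; apply/val_inj/anti_leq; have [H1 H2] := H j.
    by rewrite H2 ?H1 ?inE ?xj.
  by rewrite (key _ fu) (key _ fv).
- congr inr; have z := odd_P_staircase sx.
  move: fu fv => /=; case: s {sx} z => /= z; case: t; case: t' => //=; by rewrite z eqxx.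
Qed.

(** If the side of a given vertex does not outweigh the other one, the other side is occupied too,
    and two vertices on opposite sides share a rung or one is strictly higher. *)
Lemma odd_ff_ex : (exists u, 0 < x u) -> exists v, 0 < ff x v.
Proof.
move=> [[j t] xj].
have St : 0 < S x t.
  by rewrite /S (bigD1 j)//= ltr_pwDl// sumr_ge0.
have [ss|ss] := ltP (S x (~~ t)) (S x t).
  by exists (inl (inl t)); rewrite /= lt_max subr_gt0 ss orbT.
have [i xi] : exists i, 0 < x (i, ~~ t).
  by apply: odd_S_ex; rewrite gt_eqF// (lt_le_trans St).
have Pex s (k l : 'I_n.+1) : (k < l)%N -> 0 < x (l, s) -> 0 < x (k, ~~ s) -> 0 < P x s.
  move=> kl xl xk; rewrite /P (bigD1 l)//= ltr_pwDl//.
    rewrite (bigD1 k)//= ltr_pwDl ?mulr_gt0//.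
    by apply: sumr_ge0 => *; exact: mulr_ge0.
  by apply: sumr_ge0 => *; apply: sumr_ge0 => *; exact: mulr_ge0.
case: (ltngtP i j) => ij.
- by exists (inr t); exact: Pex ij xj xi.
- by exists (inr (~~ t)); apply: Pex ij xi _; rewrite negbK.
- exists (inl (inr j)); rewrite /= lt_min; move: xi; rewrite (val_inj ij).
  by case: t xj {St ss} => -> ->.
Qed.

End Nonneg.

Section Join.
Context (y : VJ -> R) (y0 : forall v, 0 <= y v).

Let ctot_ge i : y (inl (inr i)) <= ctot y.
Proof. by rewrite /ctot (bigD1 i)//= lerDl sumr_ge0. Qed.

Let ctot_ge0 : 0 <= ctot y. Proof. exact: sumr_ge0. Qed.
Let ntot_ge0 : 0 <= ntot y. Proof. exact: addr_ge0. Qed.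

Lemma odd_gg_ge0 u : 0 <= gg y u.
Proof. by rewrite /gg !addr_ge0// ?mulr_ge0 ?ler0n// le_max lexx. Qed.

Lemma odd_gg_neq0 j t : gg y (j, t) != 0 ->
  [\/ y (inl (inl (~~ t))) < y (inl (inr j)),
      j = star /\ ctot y + ntot y < y (inl (inl t)),
      j = ord_max /\ y (inr t) != 0 | j = ord0 /\ y (inr (~~ t)) != 0].
Proof.
rewrite /gg /=.
have [?|h1] := ltP (y (inl (inl (~~ t)))) (y (inl (inr j))); first by move=> _; exact: Or41.
rewrite (max_l (x := 0)) ?subr_le0// add0r.
have [/andP[/eqP ? ?]|h2] := boolP ((j == star) && (ctot y + ntot y < y (inl (inl t)))).
  by move=> _; exact: Or42.
have [/andP[/eqP ? ?]|h3] := boolP ((j == ord_max) && (y (inr t) != 0)).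
  by move=> _; exact: Or43.
have [/andP[/eqP ? ?]|h4] := boolP ((j == ord0) && (y (inr (~~ t)) != 0)).
  by move=> _; exact: Or44.
suff -> : (j == star)%:R * Num.max 0 (y (inl (inl t)) - ctot y - ntot y) = 0.
  suff -> : (j == ord_max)%:R * y (inr t) = 0.
    suff -> : (j == ord0)%:R * y (inr (~~ t)) = 0 by rewrite !addr0 eqxx.
    by move: h4; case: (j == ord0) => /=; [rewrite negbK mul1r => /eqP|rewrite mul0r].
  by move: h3; case: (j == ord_max) => /=; [rewrite negbK mul1r => /eqP|rewrite mul0r].
move: h2; case: (j == star) => /=; last by rewrite mul0r.
by rewrite -leNgt mul1r => h2; rewrite max_l//; lra.
Qed.

Hypothesis yJ : supp y \in rainbow odd_col.

Lemma odd_alpha_uniq t : y (inl (inl t)) != 0 -> y (inl (inl (~~ t))) = 0.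
Proof.
move=> yt; apply/eqP; apply: contraT => yt'.
move/rainbowP: yJ => /(_ (inl (inl t)) (inl (inl (~~ t)))); rewrite !inE.
by move=> /(_ yt yt' erefl) []; case: t {yt yt'}.
Qed.

Lemma odd_apex_uniq t : y (inr t) != 0 -> y (inr (~~ t)) = 0.
Proof.
move=> yt; apply/eqP; apply: contraT => yt'.
move/rainbowP: yJ => /(_ (inr t) (inr (~~ t))); rewrite !inE.
by move=> /(_ yt yt' erefl) []; case: t {yt yt'}.
Qed.

Lemma odd_mid_uniq i j : y (inl (inr i)) != 0 -> y (inl (inr j)) != 0 -> i = j.
Proof.
move=> yi yj; move/rainbowP: yJ => /(_ (inl (inr i)) (inl (inr j))); rewrite !inE.
by move=> /(_ yi yj erefl) [].
Qed.

(** If a pole [r] dominates, the side [~~ r] contains at most a cone point, and cutting at [ord0] or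
    [ord_max] works. Otherwise [star] carries no weight and the cut of [s] still works. The set [s]
    is empty when [gg] alone is studied, and is the support of [rr] in the homotopy. *)
Lemma odd_staircaseU (s : {set VK}) t (i : 'I_n.+1) :
  y (inr (~~ t)) = 0 ->
  (forall j : 'I_n.+1, ((j, t) \in s -> (i <= j)%N) /\ ((j, ~~ t) \in s -> (j <= i)%N)) ->
  (forall j, y (inl (inr j)) != 0 -> j = i) ->
  (forall r, ctot y + ntot y < y (inl (inl r)) -> forall j, (j, ~~ r) \notin s) ->
  staircase t (s :|: supp (gg y)).
Proof.
move=> yt Hs Hc Hr; apply/staircaseP.
have [/existsP[r yr]|/existsPn none] :=
    boolP [exists r, ctot y + ntot y < y (inl (inl r))].
  have yr0 : y (inl (inl (~~ r))) = 0.
    by apply: odd_alpha_uniq; rewrite gt_eqF// (le_lt_trans _ yr)// addr_ge0.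
  have nr j : (j, ~~ r) \in s :|: supp (gg y) ->
      j = ord_max /\ y (inr (~~ r)) != 0 \/ j = ord0 /\ y (inr r) != 0.
    rewrite finset.in_setU (negbTE (Hr r yr j)) /= in_supp => /odd_gg_neq0[||?|].
    - rewrite negbK => /(lt_trans yr); rewrite ltNge => /negP[].
      by apply: le_trans (ctot_ge j) _; rewrite lerDl.
    - by rewrite yr0 => -[_]; rewrite ltNge addr_ge0.
    - by left.
    - by rewrite negbK; right.
  have [rt|rt] := eqVneq r t.
    exists ord0 => j; split => //; rewrite -rt => /nr[[_]|[-> //]].
    by rewrite rt yt eqxx.
  have {}rt : t = ~~ r by case: r t rt {yt Hs Hr yr yr0 nr} => -[].
  exists ord_max => j; split; last by rewrite -ltnS.
  rewrite rt => /nr[[-> //]|[_]].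
  by move: yt; rewrite rt negbK => ->; rewrite eqxx.
exists i => j; have [H1 H2] := Hs j.
have yc r : y (inl (inl r)) < y (inl (inr j)) -> j = i.
  by move=> lt; apply: Hc; rewrite gt_eqF// (le_lt_trans _ lt).
split; rewrite finset.in_setU => /orP[//|]; rewrite in_supp => /odd_gg_neq0[/yc ->//|[_]||].
- by move=> lt; have := none t; rewrite lt.
- by move=> [-> _]; rewrite /= -ltnS.
- by rewrite yt eqxx => -[].
- by move=> lt; have := none (~~ t); rewrite lt.
- by rewrite yt eqxx => -[].
- by move=> [-> _].
Qed.

Lemma odd_staircase_gg t : y (inr (~~ t)) = 0 -> staircase t (supp (gg y)).
Proof.
move=> yt; rewrite -[supp _]finset.set0U.
have [i Hi] : exists i, forall j, y (inl (inr j)) != 0 -> j = i.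
  have [/existsP[i yi]|/existsPn none] := boolP [exists i, y (inl (inr i)) != 0].
    by exists i => j yj; exact: odd_mid_uniq.
  by exists ord0 => j yj; have := none j; rewrite yj.
by apply: (odd_staircaseU yt _ Hi) => [j|r _ j]; rewrite !inE.
Qed.

Lemma odd_supp_gg : supp (gg y) \in odd_complex.
Proof.
apply/odd_complexP; have [yt|yt] := eqVneq (y (inr true)) 0.
  by exists false; exact: odd_staircase_gg.
by exists true; apply: odd_staircase_gg; exact: odd_apex_uniq.
Qed.

(** If the image vanished, so would the apices, then the middles, because one of the two poles is
    absent, and finally the poles, from which nothing is left to subtract. *)
Lemma odd_gg_ex : (exists v, 0 < y v) -> exists u, 0 < gg y u.
Proof.
move=> [v yv]; apply/not_existsP => none.
have z u : gg y u = 0.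
  by apply/eqP; rewrite eq_le odd_gg_ge0 andbT leNgt; apply/negP; exact: none.
have A (a b c d : R) : 0 <= a -> 0 <= b -> 0 <= c -> 0 <= d -> a + b + c + d = 0 ->
    [/\ a = 0, b = 0, c = 0 & d = 0] by move=> *; split; lra.
have z4 j t : [/\ Num.max 0 (y (inl (inr j)) - y (inl (inl (~~ t)))) = 0,
    (j == star)%:R * Num.max 0 (y (inl (inl t)) - ctot y - ntot y) = 0,
    (j == ord_max)%:R * y (inr t) = 0 & (j == ord0)%:R * y (inr (~~ t)) = 0].
  by apply: A (z (j, t)); rewrite ?mulr_ge0 ?ler0n// le_max lexx.
have zN t : y (inr t) = 0.
  by have [_ _ + _] := z4 ord_max t; rewrite eqxx mul1r.
have pos (a : R) : Num.max 0 a = 0 -> a <= 0 by move=> <-; rewrite le_max lexx orbT.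
have zc j : y (inl (inr j)) = 0.
  have [t yt] : exists t, y (inl (inl (~~ t))) = 0.
    have [?|/odd_alpha_uniq ?] := eqVneq (y (inl (inl true))) 0; last by exists true.
    by exists false.
  have [/pos + _ _ _] := z4 j t; rewrite yt subr0 => yj.
  by apply/le_anti; rewrite yj y0.
have za t : y (inl (inl t)) = 0.
  have [_ + _ _] := z4 star t; rewrite eqxx mul1r /ctot /ntot !zN.
  rewrite big1 => [/pos|//]; rewrite addr0 !subr0 => yt.
  by apply/le_anti; rewrite yt y0.
by move: yv; case: v => [[t|j]|t]; rewrite ?za ?zc ?zN ltxx.
Qed.

(* Both apices put the same weight on the two sides, so the sides of the image
   compare as the weights of the two poles do. *)
Lemma odd_gg_balance t : y (inl (inl t)) != 0 -> S (gg y) (~~ t) <= S (gg y) t.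
Proof.
move=> yt; have yt0 := odd_alpha_uniq yt.
have delta (a : 'I_n.+1) (c : R) : \sum_(j < n.+1) (j == a)%:R * c = c.
  by rewrite (bigD1 a)//= eqxx mul1r big1 ?addr0// => j /negbTE ->; rewrite mul0r.
have SE s : S (gg y) s = \sum_j Num.max 0 (y (inl (inr j)) - y (inl (inl (~~ s))))
    + Num.max 0 (y (inl (inl s)) - ctot y - ntot y) + y (inr s) + y (inr (~~ s)).
  by rewrite /S /gg !big_split/= !delta.
rewrite !SE negbK yt0 -!addrA lerD//.
  apply: ler_sum => j _; rewrite subr0 ge_max le_max lexx /= le_max; apply/orP; right.
  by rewrite lerBlDr lerDl.
rewrite [_ (inr _) + _]addrC lerD//.
by rewrite ge_max le_max lexx /= le_max add0r -opprD oppr_le0 addr_ge0.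
Qed.

End Join.

(** Homogeneity lets the support of [g (f x)] be computed from the unnormalized [ff]. *)
Let gg_scale (y : VJ -> R) (c : R) u : 0 < c ->
  gg (fun v => c * y v) u = c * gg y u.
Proof.
move=> c0; have mc (a b : R) : a = c * b -> Num.max 0 a = c * Num.max 0 b.
  by move=> ->; rewrite maxr_pMr ?mulr0// ltW.
have e1 : Num.max 0 (c * y (inl (inr u.1)) - c * y (inl (inl (~~ u.2)))) =
  c * Num.max 0 (y (inl (inr u.1)) - y (inl (inl (~~ u.2)))) by apply: mc; ring.
have e2 : Num.max 0 (c * y (inl (inl u.2)) - ctot (fun v => c * y v) - ntot (fun v => c * y v)) =
  c * Num.max 0 (y (inl (inl u.2)) - ctot y - ntot y).
  by apply: mc; rewrite /ctot -mulr_sumr /ntot; ring.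
by rewrite /gg e1 e2; ring.
Qed.

Let eq_gg (y y' : VJ -> R) u : y =1 y' -> gg y u = gg y' u.
Proof. by move=> /funext ->. Qed.

Let rr_ge0 (x : X) u : 0 <= rr (bary x) u.
Proof. by rewrite mulr_ge0 ?bary_ge0// le_max lexx. Qed.

Let supp_rr (x : X) : supp (rr (bary x)) \subset supp (bary x).
Proof.
by apply/fintype.subsetP => u; rewrite !inE mulf_eq0 negb_or => /andP[].
Qed.

Let ff_pos (x : X) v : 0 <= ff (bary x) v.
Proof. by apply: odd_ff_ge0; exact: bary_ge0. Qed.

(** The heavier side survives. If the sides balance, both poles vanish, so some middle or apex is
    positive and so is the factor [ctot + ntot]. *)
Let rr_ex (x : X) : exists u, 0 < rr (bary x) u.
Proof.
have [t tS] : exists t, S (bary x) (~~ t) <= S (bary x) t.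
  by case: (leP (S (bary x) true) (S (bary x) false)) => [?|/ltW ?]; [exists false|exists true].
have SE : S (bary x) t + S (bary x) (~~ t) = 1.
  rewrite -(bary_sum x) (eq_bigr (fun u => bary x (u.1, u.2))) => [|[]//].
  rewrite -(pair_bigA _ (fun j t => bary x (j, t)))/= /S -big_split/=.
  by apply: eq_bigr => j _; rewrite big_bool; case: (t); rewrite // addrC.
have [j xj] : exists j, 0 < bary x (j, t).
  by apply: odd_S_ex; [exact: bary_ge0|apply/eqP; lra].
exists (j, t); rewrite mulr_gt0//= lt_max; apply/orP; right.
have c0 : 0 <= ctot (ff (bary x)) by apply: sumr_ge0 => i _; exact: ff_pos.
have n0 : 0 <= ntot (ff (bary x)) by apply: addr_ge0; exact: ff_pos.
have [v fv] := odd_ff_ex (bary_ge0 x) (bary_gt0_ex x).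
case: v fv => [[s|i]|s] fv.
- have : 0 < S (bary x) s - S (bary x) (~~ s).
    by apply: max0_neq0; move: fv => /=; exact: lt0r_neq0.
  have [->|st] := eqVneq s t; first lra.
  have -> : s = ~~ t by case: s t st {tS SE xj fv} => -[].
  by rewrite negbK; lra.
- suff : 0 < ctot (ff (bary x)) by lra.
  apply: lt_le_trans fv _; rewrite /ctot (bigD1 i)//= lerDl.
  by apply: sumr_ge0 => k _; exact: (ff_pos x (inl (inr k))).
- suff : 0 < ntot (ff (bary x)) by lra.
  apply: lt_le_trans fv _; rewrite /ntot.
  by case: (s); [rewrite lerDl|rewrite lerDr]; exact: (ff_pos x (inr _)).
Qed.

Let cont_S t : continuous (fun x : X => S (bary x) t).
Proof. by apply: cont_sum => j _; exact: cont_bary. Qed.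

Let cont_ff v : continuous (fun x : X => ff (bary x) v).
Proof.
case: v => [[t|i]|t] /=.
- apply: cont_max; first exact: cont_cst.
  by apply: contD; [exact: cont_S|exact/contN/cont_S].
- by apply: cont_min; exact: cont_bary.
- by apply: cont_sum => j _; apply: cont_sum => i _; apply: contM; exact: cont_bary.
Qed.

Let cont_rr u : continuous (fun x : X => rr (bary x) u).
Proof.
apply: contM; first exact: cont_bary.
apply: cont_max; first exact: cont_cst.
apply: contD; last exact/contN/cont_S.
apply: contD; first exact: cont_S.
apply: contD; last by apply: contD; exact: cont_ff.
apply: (@cont_sum _ _ _ _ (fun i (x : X) => ff (bary x) (inl (inr i)))) => i _.
exact: cont_ff.
Qed.

Let cont_gg u : continuous (fun y : Y => gg (bary y) u).
Proof.
have cB (f g : Y -> R) : continuous f -> continuous g -> continuous (fun y => f y - g y).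
  by move=> cf cg; apply: contD => //; exact: contN.
have cZ (a : R) (f : Y -> R) : continuous f -> continuous (fun y => a * f y).
  by move=> cf; apply: contM => //; exact: cont_cst.
have cb v : continuous (fun y : Y => bary y v) by exact: cont_bary.
apply: contD; last exact: (cZ).
apply: contD; last exact: (cZ).
apply: contD; first by apply: cont_max; [exact: cont_cst|exact: cB].
apply: (cZ); apply: cont_max; first exact: cont_cst.
apply: (cB _ _); last exact: contD.
by apply: (cB _ _) => //; apply: cont_sum => i _; exact: cb.
Qed.

Lemma odd_rainbow : @hequiv R X Y.
Proof.
have [f cf fE] : exists2 f : X -> Y, continuous f
    & forall x, exists2 c : R, 0 < c & forall v, bary (f x) v = c * ff (bary x) v.
  apply: (@raw_map_normalize R VJ (rainbow odd_col) X (fun x => ff (bary x))).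
  split => // x; first by apply: odd_ff_ex; [exact: bary_ge0|exact: bary_gt0_ex].
  by apply: odd_supp_ff; [exact: bary_ge0|exact: supp_bary].
have [g cg gE] : exists2 g : Y -> X, continuous g
    & forall y, exists2 c : R, 0 < c & forall u, bary (g y) u = c * gg (bary y) u.
  apply: (@raw_map_normalize R _ odd_complex Y (fun y => gg (bary y))).
  split => // y.
  - by move=> u; apply: odd_gg_ge0; exact: bary_ge0.
  - by apply: odd_gg_ex; [exact: bary_ge0|exact: supp_bary|exact: bary_gt0_ex].
  - by apply: odd_supp_gg; [exact: bary_ge0|exact: supp_bary].
have [r cr rs] : exists2 r : X -> X, continuous r
    & forall x, supp (bary (r x)) = supp (rr (bary x)).
  apply: (@raw_map_supp R _ odd_complex X (fun x => rr (bary x))); split => // x.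
  exact: downclosed_odd (supp_bary x) (supp_rr x).
have fs x v : (bary (f x) v != 0) = (ff (bary x) v != 0).
  by have [c c0 ->] := fE x; rewrite mulf_eq0 gt_eqF.
have gs y : supp (bary (g y)) = supp (gg (bary y)).
  by have [c c0 E] := gE y; apply/setP => u; rewrite !inE E mulf_eq0 gt_eqF.
have gfs x : supp (bary (g (f x))) = supp (gg (ff (bary x))).
  rewrite gs; have [c c0 E] := fE x; apply/setP => u.
  by rewrite !inE (eq_gg _ E) gg_scale// mulf_eq0 gt_eqF.
exists f, g; split => //.
- apply: (@homotopic_in_trans _ _ _ _ _ r); last first.
    apply: homotopic_in_top; apply: line_homotopy => //.
    + exact: downclosed_odd.
    + by move=> x; exact: cvg_id.
    + by move=> x; rewrite rs (finset.setUidPr (supp_rr x)) supp_bary.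
  apply: homotopic_in_top; apply: line_homotopy => //.
  + exact: downclosed_odd.
  + by move=> x; apply: continuous_comp; [exact: cf|exact: cg].
  + move=> x /=; have x0 := bary_ge0 x; rewrite gfs rs finset.setUC.
    have fJ : supp (ff (bary x)) \in rainbow odd_col.
      by apply: odd_supp_ff => //; exact: supp_bary.
    have /odd_complexP[t tx] := supp_bary x.
    apply/odd_complexP; exists t; move: (tx) => /staircaseP[i Hi].
    apply: (@odd_staircaseU _ _ fJ _ _ i) => //.
    * exact: (odd_P_staircase x0 tx).
    * by move=> j; have [H1 H2] := Hi j; split => /(fintype.subsetP (supp_rr x)).
    * move=> j /(odd_mid_neq0 x0) xj; apply/val_inj/anti_leq; have [H1 H2] := Hi j.
      by rewrite H2 ?H1 ?inE ?xj.
    (* The pole weight at which [star] appears is the one at which [rr] has erased the opposite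
       side. *)
    * move=> s /= lt j; rewrite inE negbK /rr /= mulf_eq0 negbK max_l ?eqxx ?orbT//.
      have c0 : 0 <= ctot (ff (bary x)) by apply: sumr_ge0 => k _; exact: ff_pos.
      have n0 : 0 <= ntot (ff (bary x)) by apply: addr_ge0; exact: ff_pos.
      by move: lt; rewrite lt_max => /orP[|]; lra.
- apply: homotopic_in_top; apply: line_homotopy.
  + exact: downclosed_rainbow.
  + by move=> y; apply: continuous_comp; [exact: cg|exact: cf].
  + by move=> y; exact: cvg_id.
  + move=> y /=; have y0 := bary_ge0 y; have x0 := bary_ge0 (g y).
    have yJ := supp_bary y.
    apply: rainbowU_cross; [exact: supp_bary|exact: supp_bary|].
    have [c c0 gyE] := gE y.
    case=> [[t|i]|t] [[t'|i']|t']; rewrite !in_supp fs => fu yv E;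
      try by move/(congr1 val): E; rewrite /= ?inordK.
    * congr (inl (inl _)); apply/eqP; apply: contraT => tt'.
      have {}tt' : t = ~~ t' by case: t t' tt' {fu yv E} => -[].
      move: fu; rewrite tt' /= negbK => /max0_neq0.
      have SE s : S (bary (g y)) s = c * S (gg (bary y)) s.
        by rewrite /S mulr_sumr; apply: eq_bigr => j _; rewrite gyE.
      by rewrite !SE subr_gt0 ltr_pM2l// ltNge odd_gg_balance.
    * congr (inl (inr _)); apply/eqP; apply: contraT => ii'.
      (* Both ends of the rung [i] occur in [g y] although [y] has no weight on its middle. They
         would come from poles or apices, but [star], [ord0] and [ord_max] are distinct rungs, and
         on each of them only one end is used. *)
      have yi : bary y (inl (inr i)) = 0.
        by apply/eqP; apply: contraNT ii' => yi; apply/eqP; exact: (odd_mid_uniq yJ).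
      have gi t : gg (bary y) (i, t) != 0.
        by have := odd_mid_neq0 x0 fu t; rewrite gyE mulf_eq0 gt_eqF.
      have no_mid s : ~ (bary y (inl (inl s)) < bary y (inl (inr i))).
        by rewrite yi; apply/negP; rewrite -leNgt.
      have no_star s : (ctot (bary y) + ntot (bary y) < bary y (inl (inl s))) ->
          ~ (ctot (bary y) + ntot (bary y) < bary y (inl (inl (~~ s)))).
        have p : 0 <= ctot (bary y) + ntot (bary y).
          by rewrite addr_ge0 ?addr_ge0// sumr_ge0.
        by move=> lt; rewrite (odd_alpha_uniq yJ) ?gt_eqF ?(le_lt_trans p)//; lra.
      have no_apex s : bary y (inr s) != 0 -> ~ (bary y (inr (~~ s)) != 0).
        by move=> ys; rewrite (odd_apex_uniq yJ ys) eqxx.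
      have s0 : star <> ord0 by move/(congr1 val); rewrite /= inordK// ltnW.
      have sm : star <> ord_max.
        by move/(congr1 val); rewrite /= inordK ?ltnS ?(ltnW n2)// => e; move: n2; rewrite -e.
      have m0 : ord_max <> ord0 :> 'I_n.+1.
        by move/(congr1 val) => /= e; move: n2; rewrite e.
      have := odd_gg_neq0 (gi true); have := odd_gg_neq0 (gi false).
      case=> [/no_mid//|[d a]|[d a]|[d a]]; case=> [/no_mid//|[e b]|[e b]|[e b]];
        rewrite d in e; try by first [case: (s0 e)|case: (sm e)|case: (m0 e)
          |case: (s0 (esym e))|case: (sm (esym e))|case: (m0 (esym e))].
      - by case: (no_star _ a b).
      - by case: (no_apex _ a b).
      - by case: (no_apex _ a b).
    * congr inr; apply/eqP; apply: contraT => tt'.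
      have {}tt' : t = ~~ t' by case: t t' tt' {fu yv E} => -[].
      have yt : bary y (inr (~~ t')) = 0 by exact: (odd_apex_uniq yJ).
      have := odd_staircase_gg y0 yJ yt; rewrite -gs => /(odd_P_staircase x0).
      by move: fu; rewrite tt' /= => /eqP.
Qed.

(** In a triangle without base vertex the pole and the apex are forced; only the rung is free. *)
Lemma odd_wedge : @hequiv R X (wedge_of_spheres R 2 n).
Proof.
apply: hequiv_trans odd_rainbow _.
pose vert (t : bool) (i : 'I_n.+1) (k : 'I_3) : VJ :=
  if k == ord0 then inl (inl t) else if k == inord 1 then inl (inr i) else inr t.
have v0 t i : vert t i ord0 = inl (inl t) by [].
have v1 t i : vert t i (inord 1) = inl (inr i).
  by rewrite /vert eqxx ifF// -val_eqE /= inordK.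
have v2 t i : vert t i (inord 2) = inr t.
  by rewrite /vert !ifF// -val_eqE /= !inordK.
have colv t i k : odd_col (vert t i k) = k.
  by case: (ord3_cases k) => ->; rewrite !(v0, v1, v2).
pose base := vert false ord0.
have nbE i k : nonbase odd_col base (vert true (lift ord0 i) k).
  by rewrite /nonbase colv /base; case: (ord3_cases k) => ->; rewrite !(v0, v1, v2).
apply: (@rainbow_wedge_fin R VJ odd_col base 'I_n (fun i => vert true (lift ord0 i))) => //.
- exact: colv.
- exact: ltnW.
- by rewrite card_ord.
- move=> i j H; have := H (inord 1); rewrite !v1 => -[] e; exact: val_inj.
- move=> u uP.
  have u0 : u ord0 = inl (inl true).
    have [] := uP ord0; rewrite /nonbase => ->; rewrite /base v0.
    by case: (u ord0) (uP ord0).1 => [[[]|i]|t] //= /(congr1 val); rewrite /= ?inordK.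
  have [i ui] : exists i, u (inord 1) = inl (inr (lift ord0 i)).
    have [] := uP (inord 1); rewrite /nonbase => ->; rewrite /base v1.
    case: (u (inord 1)) (uP (inord 1)).1 => [[t|i]|t] /= /(congr1 val); rewrite /= ?inordK// => _.
    by case: (unliftP ord0 i) => [i' ->|->]; [exists i'|rewrite eqxx].
  have uc : u (inord 2) = inr true.
    have [] := uP (inord 2); rewrite /nonbase => ->; rewrite /base v2.
    by case: (u (inord 2)) (uP (inord 2)).1 => [[t|j]|[]] //= /(congr1 val); rewrite /= ?inordK.
  by exists i => k; case: (ord3_cases k) => ->; rewrite !(v0, v1, v2).
Qed.

End OddComplex.

(** * Total cuts of the circular ladder *)

Section LadderCuts.
Context (p : nat).
Notation n := p.+1.
Notation e := (@circular_ladder n).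
Notation K := (total_cut_complex e p).

Let ordS_small (j : 'I_n) : (j < p)%N -> ordS j = j.+1 :> nat.
Proof. by move=> jp; rewrite /= modn_small. Qed.

Let ordS_max : ordS (ord_max : 'I_n) = ord0.
Proof. by apply: val_inj; rewrite /= modnn. Qed.

(* [sg j] is the vertex chosen on rung [j]; the rung [i] is left out. *)
Definition alternating (i : 'I_n) (sg : 'I_n -> bool) :=
  forall j, j != i -> ordS j != i -> sg j != sg (ordS j).

Definition rung_set (i : 'I_n) (sg : 'I_n -> bool) : {set 'I_n * bool} :=
  [set u : 'I_n * bool | (u.1 != i) && (u.2 == sg u.1)]%SET.

Lemma independentP (S : {set 'I_n * bool}) :
  reflect (forall u v, u \in S -> v \in S -> ~~ e u v) (independent e S).
Proof.
apply: (iffP forall_inP) => [H u v us vs|H u us].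
  by move/forall_inP: (H u us); exact.
by apply/forall_inP => v vs; exact: H.
Qed.

Lemma independent_rung_set i sg : alternating i sg -> independent e (rung_set i sg).
Proof.
move=> alt; apply/independentP => -[j s] [k r]; rewrite !inE /=.
move=> /andP[ji /eqP ->] /andP[ki /eqP ->]; rewrite /circular_ladder /=.
apply/negP => /orP[/andP[/eqP sjk /orP[/eqP kE|/eqP jE]]|/andP[/eqP -> ]].
- by move: (alt j ji); rewrite -kE ki sjk eqxx => /(_ isT).
- by move: (alt k ki); rewrite -jE ji sjk eqxx => /(_ isT).
- by rewrite eqxx.
Qed.

Lemma card_rung_set i sg : #|rung_set i sg| = p.
Proof.
have -> : rung_set i sg = (fun j => (j, sg j)) @: (~: [set i]).
  apply/setP => -[j s]; rewrite inE /=; apply/andP/imsetP => [[ji /eqP ->]|[k + [-> ->]]].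
    by exists j => //; rewrite !inE.
  by rewrite !inE.
by rewrite card_imset ?cardsC1 ?card_ord// => j k [].
Qed.

(** The two ends of a rung are adjacent, so [S] projects injectively to the rungs and, by its size,
    misses exactly one. *)
Lemma independent_rung_setE (S : {set 'I_n * bool}) : independent e S -> #|S| = p ->
  exists i sg, alternating i sg /\ S = rung_set i sg.
Proof.
move=> /independentP indep cS.
have inj : {in S &, injective fst}.
  move=> [j s] [k r] us vs /= jk; rewrite -{k}jk in vs *.
  have := indep _ _ us vs; rewrite /circular_ladder /= eqxx /= negb_or negbK.
  by move=> /andP[_ /eqP ->].
have c1 : #|fst @: S| = p by rewrite card_in_imset.
have /cards1P[i iE] : #|~: (fst @: S)| == 1%N.
  by rewrite cardsCs finset.setCK c1 card_ord subSnn.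
have inS j : j != i -> exists s, (j, s) \in S.
  move=> ji; have : j \in fst @: S.
    by apply: contraNT ji; rewrite -finset.in_setC iE inE.
  by move=> /imsetP[[k s] ks ->]; exists s.
have out j s : (j, s) \in S -> j != i.
  move=> js; apply: contraTneq (imset_f fst js) => /= ->.
  by rewrite -finset.in_setC iE inE.
pose sg j := (j, true) \in S.
have sgE j s : j != i -> ((j, s) \in S) = (s == sg j).
  move=> ji; have [r jr] := inS j ji.
  have one a b : (j, a) \in S -> (j, b) \in S -> a = b.
    by move=> ja jb; have [] := inj _ _ ja jb erefl.
  rewrite /sg; case: s; first by rewrite -[RHS]eq_sym eqb_id.
  case: r jr => jr; rewrite ?jr.
    by apply/negP => jf; have := one _ _ jr jf.
  by apply/esym; rewrite eq_sym eqbF_neg; apply/negP => jt; have := one _ _ jr jt.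
exists i, sg; split; last first.
  apply/setP => -[j s]; rewrite inE /=; have [->|ji] := eqVneq j i.
    by apply/negP => /out; rewrite eqxx.
  by rewrite sgE.
move=> j ji ji'; apply/negP => /eqP E.
have := indep (j, sg j) (ordS j, sg (ordS j)); rewrite !sgE// !eqxx => /(_ isT isT).
by rewrite /circular_ladder /= E !eqxx.
Qed.

Lemma ladder_cutP (s : {set 'I_n * bool}) :
  reflect (exists i sg, alternating i sg /\ forall j, j != i -> (j, sg j) \notin s)
          (s \in K).
Proof.
apply: (iffP idP) => [|[i [sg [alt H]]]]; rewrite inE.
  move=> /exists_inP[_ /imsetP[S + ->] sS]; rewrite inE => /andP[iS /eqP cS].
  have [i [sg [alt SE]]] := independent_rung_setE iS cS; exists i, sg; split => // j ji.
  apply: contraTN sS => js; apply/fintype.subsetPn; exists (j, sg j) => //.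
  by rewrite inE negbK SE inE ji eqxx.
apply/exists_inP; exists (~: rung_set i sg).
  apply/imsetP; exists (rung_set i sg) => //.
  by rewrite inE independent_rung_set// card_rung_set eqxx.
apply/fintype.subsetP => -[j r] js; rewrite !inE /=; apply/negP => /andP[ji /eqP rE].
by have := H j ji; rewrite -rE js.
Qed.

Lemma ladder_dim : complex_dim K = n.
Proof.
rewrite /complex_dim; suff -> : \max_(s in K) #|s| = n.+1 by [].
have cC (S : {set 'I_n * bool}) : #|S| = p -> #|~: S| = n.+1.
  move=> cS; rewrite cardsCs finset.setCK cS card_prod card_ord card_bool muln2 -addnn.
  by rewrite -{1}(addn1 p) -addnA addKn.
apply/eqP; rewrite eqn_leq; apply/andP; split.
  apply/bigmax_leqP => s; rewrite inE => /exists_inP[_ /imsetP[S + ->] sS].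
  by rewrite inE => /andP[_ /eqP cS]; rewrite -(cC S cS) subset_leq_card.
(* Leaving out the rung 0 removes the wrap-around edges, so parity alternates whatever the number of
   rungs; this provides a facet. *)
have alt : alternating ord0 (fun j => odd j).
  move=> j _; have [->|jp] := eqVneq j ord_max; first by rewrite ordS_max.
  have jp' : (j < p)%N by move: jp; rewrite -val_eqE /= ltn_neqAle -ltnS ltn_ord andbT.
  by rewrite ordS_small//=; case: (odd j).
rewrite -(cC _ (card_rung_set ord0 (fun j => odd j))); apply: leq_bigmax_cond.
apply/ladder_cutP; exists ord0, (fun j => odd j); split => // j j0.
by rewrite !inE negbK j0 eqxx.
Qed.

(** * The relabelled side of an alternating choice *)

Section Types.
Context (i : 'I_n) (sg : 'I_n -> bool).
Hypothesis alt : alternating i sg.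
Let ty (j : 'I_n) := sg j (+) odd j.

Let ty_step (j k : 'I_n) : k = j.+1 :> nat -> j != i -> k != i -> ty j = ty k.
Proof.
move=> kE ji ki; have jp : (j < p)%N by rewrite -ltnS -kE.
have E : ordS j = k by apply: ord_inj; rewrite ordS_small.
have := alt ji; rewrite E ki => /(_ isT); rewrite /ty kE /=.
by case: (sg j); case: (sg k); case: (odd j).
Qed.

Let ty_const d (j k : 'I_n) : k = (j + d)%N :> nat ->
  (forall l : 'I_n, (j <= l <= k)%N -> l != i) -> ty j = ty k.
Proof.
elim: d k => [|d IH] k kE H; first by congr ty; apply: ord_inj; rewrite kE addn0.
have lt : (j + d < n)%N by rewrite (leq_ltn_trans _ (ltn_ord k))// kE leq_add2l.
rewrite (IH (Ordinal lt))//= => [|l /andP[jl lk]].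
  apply: ty_step; first by rewrite kE addnS.
    by apply: H; rewrite /= leq_addr kE leq_add2l leqnSn.
  by apply: H; rewrite kE leq_addr leqnn.
by apply: H; rewrite jl kE (leq_trans lk)// leq_add2l.
Qed.

Lemma ty_below (j : 'I_n) : (j < i)%N -> ty j = ty ord0.
Proof.
move=> ji; apply/esym/(@ty_const j); rewrite ?add0n// => l /andP[_ lj].
by rewrite -val_eqE /= ltn_eqF// (leq_ltn_trans lj).
Qed.

Lemma ty_above (j : 'I_n) : (i < j)%N -> ty j = ty ord_max.
Proof.
move=> ij; apply: (@ty_const (p - j)).
  by rewrite /= subnKC// -ltnS.
by move=> l /andP[jl _]; rewrite -val_eqE /= gtn_eqF// (leq_trans ij).
Qed.

(** From the last rung to the first, alternation changes the side and the relabelling contributes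
    [odd p]; the two cancel exactly when the number [p.+1] of rungs is even. *)
Lemma ty_wrap : (0 < i)%N -> (i < p)%N -> ty ord_max = odd p (+) ~~ ty ord0.
Proof.
move=> i0 ip; have := alt (j := ord_max); rewrite ordS_max.
rewrite -!val_eqE /= [p == i]eq_sym (ltn_eqF ip) (ltn_eqF i0) => /(_ isT isT).
by rewrite /ty /=; case: (sg _); case: (sg _); case: (odd p).
Qed.

End Types.

Definition relabel (u : 'I_n * bool) : 'I_n * bool := (u.1, u.2 (+) odd u.1).

Lemma relabelK : involutive relabel.
Proof. by case=> j s; rewrite /relabel /= -addbA addbb addbF. Qed.

Lemma mem_relabel j t (s : {set 'I_n * bool}) :
  ((j, t) \in relabel @: s) = ((j, t (+) odd j) \in s).
Proof.
rewrite -[(j, t (+) _)]/(relabel (j, t)) -[(j, t) in LHS]relabelK.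
by rewrite mem_imset//; exact: inv_inj relabelK.
Qed.

Lemma ladder_even (s : {set 'I_n * bool}) : odd p ->
  (s \in K) = (relabel @: s \in even_complex p).
Proof.
move=> op; apply/ladder_cutP/even_complexP => [[i [sg [alt H]]]|[t [i H]]].
  pose ty (j : 'I_n) := sg j (+) odd j.
  have [t Ht] : exists t, forall j, j != i -> ty j = t.
    (* The rungs below [i] agree with the first rung, those above with the last; for [i = 0] only
       the latter exist. *)
    exists (if (0 < i)%N then ty ord0 else ty ord_max) => j ji.
    have [jlt|jgt|] := ltngtP j i; last by move=> /val_inj/eqP; rewrite (negbTE ji).
      by rewrite (leq_ltn_trans (leq0n _) jlt); exact: (ty_below alt).
    have -> : ty j = ty ord_max by exact: (ty_above alt).
    case: ifP => // i0; have ip : (i < p)%N by rewrite (leq_trans jgt)// -ltnS.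
    by rewrite /ty (ty_wrap alt i0 ip) op /= negbK.
  exists t, i => j; rewrite mem_relabel => js; apply/eqP; apply: contraT => ji.
  have := H j ji; have <- : t (+) odd j = sg j by rewrite -(Ht j ji) /ty -addbA addbb addbF.
  by rewrite js.
exists i, (fun j => t (+) odd j); split.
  move=> j _ _; have [->|jp] := eqVneq j ord_max.
    by rewrite ordS_max /= op; case: t {H}.
  have jp' : (j < p)%N by move: jp; rewrite -val_eqE /= ltn_neqAle -ltnS ltn_ord andbT.
  by rewrite ordS_small//=; case: (odd j); case: t {H}.
by move=> j ji; apply: contra ji => js; apply/eqP/H; rewrite mem_relabel.
Qed.

Lemma ladder_odd (s : {set 'I_n * bool}) : ~~ odd p ->
  (s \in K) = (relabel @: s \in odd_complex p).
Proof.
move=> op; apply/ladder_cutP/odd_complexP => [[i [sg [alt H]]]|[t /staircaseP[i H]]].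
  pose ty (j : 'I_n) := sg j (+) odd j.
  have [t [Hb Ha]] : exists t, (forall j : 'I_n, (j < i)%N -> ty j = t) /\
      (forall j : 'I_n, (i < j)%N -> ty j = ~~ t).
    exists (if (0 < i)%N then ty ord0 else ~~ ty ord_max); split => j ji.
      by rewrite (leq_ltn_trans (leq0n _) ji); exact: (ty_below alt).
    have -> : ty j = ty ord_max by exact: (ty_above alt).
    case: ifP => [i0|_]; last by rewrite negbK.
    have ip : (i < p)%N by rewrite (leq_trans ji)// -ltnS.
    by rewrite /ty (ty_wrap alt i0 ip) (negbTE op).
  have sgE j r : ty j = r -> r (+) odd j = sg j by move=> <-; rewrite /ty -addbA addbb addbF.
  exists t; apply/staircaseP; exists i => j; rewrite !mem_relabel; split => js.
    rewrite leqNgt; apply/negP => ji.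
    have := H j; rewrite -val_eqE /= (ltn_eqF ji) => /(_ isT).
    by rewrite -(sgE _ _ (Hb j ji)) js.
  rewrite leqNgt; apply/negP => ji.
  have := H j; rewrite -val_eqE /= (gtn_eqF ji) => /(_ isT).
  by rewrite -(sgE _ _ (Ha j ji)) js.
(* The change of side across the omitted rung makes up for the parity defect at the wrap-around. *)
exists i, (fun j => t (+) (i < j)%N (+) odd j); split.
  move=> j ji _; have [jE|jp] := eqVneq j ord_max.
    have ip : (i < p)%N.
      by rewrite ltn_neqAle -ltnS ltn_ord andbT; move: ji; rewrite jE -val_eqE /= eq_sym.
    by rewrite jE ordS_max /= ip (negbTE op); case: t {H}.
  have jp' : (j < p)%N by move: jp; rewrite -val_eqE /= ltn_neqAle -ltnS ltn_ord andbT.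
  have ij : (i < j.+1)%N = (i < j)%N.
    by rewrite ltnS leq_eqVlt (_ : (i == j :> nat) = false)//; apply/negbTE; rewrite eq_sym.
  rewrite ordS_small// ij /=.
  by case: t {H}; case: (i < j)%N; case: (odd j).
move=> j ji; have [H1 H2] := H j; rewrite !mem_relabel in H1 H2.
apply/negP; have [jlt|jgt|/val_inj/eqP] := ltngtP j i; last by rewrite (negbTE ji).
  by rewrite addbF => /H1; rewrite leqNgt jlt.
by rewrite addbT => /H2; rewrite leqNgt jgt.
Qed.

End LadderCuts.

Theorem theorem4p5 (R : realType) (n : nat) (hn : (3 <= n)%N) :
  let K := total_cut_complex (@circular_ladder n) (n - 1)%N in
  [/\ complex_dim K = n,
      odd n ->
        homotopy_equivalent R (realization R K)
          (wedge_of_spheres R 2 (n - 1)%N)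
    & ~~ odd n ->
        homotopy_equivalent R (realization R K)
          (wedge_of_spheres R 2 ((n - 1) ^ 2)%N)].
Proof.
case: n hn => // p hp; rewrite subn1 /=; split; first exact: ladder_dim.
- move=> op; apply: hequiv_homotopy_equivalent; apply: hequiv_trans (odd_wedge hp).
  by apply: (hequiv_relabel (@relabelK p) (@relabelK p)) => s; exact: ladder_odd.
- rewrite negbK => op; apply: hequiv_homotopy_equivalent.
  apply: hequiv_trans (even_wedge (ltnW hp)).
  by apply: (hequiv_relabel (@relabelK p) (@relabelK p)) => s; exact: ladder_even.
Qed.
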